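(* Let $\alpha,\beta>0$, let $\omega\ge0$, let $A$ be a densely defined closed linear operator on a complex Banach space $X$ with $A\in\mathcal{C}^{\alpha,\beta}(\omega)$, and let $\{S_{\alpha,\beta}(t)\}_{t>0}$ be the $(g_\alpha,g_\beta)$-regularized resolvent family generated by $A$. Then, for every $t>0$: (i) $m_{\alpha,\beta}^{\lambda}(t)\in\sigma(S_{\alpha,\beta}(t))$ for $\lambda\in\sigma(A)$; (ii) $m_{\alpha,\beta}^{\lambda}(t)\in\sigma_p(S_{\alpha,\beta}(t))$ for $\lambda\in\sigma_p(A)$; (iii) $m_{\alpha,\beta}^{\lambda}(t)\in\sigma_a(S_{\alpha,\beta}(t))$ for $\lambda\in\sigma_a(A)$; (iv) $m_{\alpha,\beta}^{\lambda}(t)\in\sigma_r(S_{\alpha,\beta}(t))$ for $\lambda\in\sigma_r(A)$.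
   Context: For $\gamma>0$, $g_\gamma(t):=t^{\gamma-1}/\Gamma(\gamma)$, $t>0$. Mittag-Leffler function: $E_{\alpha,\beta}(z):=\sum_{n=0}^\infty \frac{z^n}{\Gamma(\alpha n+\beta)}$, $\alpha,\beta>0$, $z\in\mathbb{C}$. For $a\in\mathbb{C}$, $t>0$: $m_{\alpha,\beta}^{a}(t):=t^{\beta-1}E_{\alpha,\beta}(at^\alpha)$. $\mathcal{B}(X)$ is the space of bounded linear operators on $X$. A family $\{S_{\alpha,\beta}(t)\}_{t>0}\subset\mathcal{B}(X)$ is a $(g_\alpha,g_\beta)$-regularized resolvent family generated by $A$ if: (a) $S_{\alpha,\beta}(t)$ is strongly continuous for $t>0$ and $\lim_{t\to0^+}S_{\alpha,\beta}(t)x/g_\beta(t)=x$ for all $x\in X$; (b) $S_{\alpha,\beta}(t)A\subset AS_{\alpha,\beta}(t)$ for $t>0$, i.e. for $x\in D(A)$, $S_{\alpha,\beta}(t)x\in D(A)$ and $AS_{\alpha,\beta}(t)x=S_{\alpha,\beta}(t)Ax$; (c) $S_{\alpha,\beta}(t)x=g_\beta(t)x+A\left(\int_0^t g_\alpha(t-s)S_{\alpha,\beta}(s)x\,ds\right)$ for all $x\in X$, $t>0$. $A\in\mathcal{C}^{\alpha,\beta}(\omega)$ means that $A$ generates a $(g_\alpha,g_\beta)$-regularized resolvent family $\{S_{\alpha,\beta}(t)\}_{t>0}$ such that $S_{\alpha,\beta}(\cdot)x\in L^1_{loc}([0,\infty),X)$ for all $x\in X$ and which is Laplace transformable of parameter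 $\omega$, i.e. $\int_0^\infty e^{-\lambda t}S_{\alpha,\beta}(t)x\,dt$ converges (as $\lim_{\tau\to\infty}\int_0^\tau$) for all $x\in X$ and all $\Re\lambda>\omega$. For a closed operator $B$: $\sigma(B)$ is the spectrum; $\sigma_p(B)$ the point spectrum ($\lambda-B$ not injective); $\sigma_a(B)$ the approximate point spectrum ($\lambda-B$ not injective or its range not closed; equivalently there are $x_n\in D(B)$, $\|x_n\|=1$, with $\|(\lambda-B)x_n\|\to0$); $\sigma_r(B)$ the residual spectrum (the range of $\lambda-B$ is not dense in $X$), following the conventions of Engel and Nagel. *)

(* Defs.v *)
From HB Require Import structures.
From mathcomp Require Export all_boot all_order all_algebra.
From mathcomp Require Export complex.
From mathcomp Require Export all_classical all_reals all_analysis.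

Set Implicit Arguments.
Unset Strict Implicit.
Unset Printing Implicit Defensive.

Export Order.TTheory GRing.Theory Num.Theory.
Export numFieldNormedType.Exports.
Local Open Scope classical_set_scope.
Local Open Scope complex_scope.
Local Open Scope ring_scope.

Section special_functions.
Context {R : realType}.
Implicit Types (a b t : R) (z l : R[i]).

Definition Gamma a : R :=
  \int[lebesgue_measure]_(t in `]0, +oo[) (t `^ (a - 1) * expR (- t)).

Definition g_ a t : R := t `^ (a - 1) / Gamma a.

Definition cexp z : R[i] :=
  (expR (complex.Re z))%:C * (cos (complex.Im z) +i* sin (complex.Im z)).

(* The copy [R[i]^o] of [R[i]] is the one that carries the topology of the
   modulus. *)
Definition mittag_leffler a b z : R[i] :=
  lim ((series (fun n => z ^+ n * ((Gamma (a * n%:R + b))^-1)%:C) : nat -> R[i]^o)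
       @ \oo).

Definition ml_ a b l t : R[i] :=
  (t `^ (b - 1))%:C * mittag_leffler a b (l * (t `^ a)%:C).

End special_functions.

Section bochner.
Context d (T : measurableType d) (R : realType).
Variables (mu : {measure set T -> \bar R}) (X : completeNormedModType R[i]).
Implicit Types (s : seq (set T * X)) (D : set T) (f : T -> X).

(* A list of pairs (E, c) encodes the step function sum of 1_E c; the sets E
   may overlap. *)
Definition step_valid s :=
  forall p, p \in s -> measurable p.1 /\ (mu p.1 < +oo)%E.

Definition step_fun s (t : T) : X :=
  \sum_(p <- s) (\1_(p.1) t : R)%:C *: p.2.

Definition step_int D s : X :=
  \sum_(p <- s) (fine (mu (p.1 `&` D)))%:C *: p.2.

(* f is a strong (almost everywhere) limit of step functions that also converge
   to f in L^1(D), and v is the limit of their integrals.  The norm of [X] takes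
   its values in [R[i]], hence the real part. *)
Definition has_bochner D f (v : X) := exists s : nat -> seq (set T * X),
  [/\ forall n, step_valid (s n),
      {ae mu, forall t, D t -> step_fun (s n) t @[n --> \oo] --> f t},
      (\int[mu]_(t in D) (complex.Re `|f t - step_fun (s n) t|)%:E)%E
        @[n --> \oo] --> 0%E &
      step_int D (s n) @[n --> \oo] --> v].

Definition bochner_integrable D f := exists v, has_bochner D f v.

(* This is 0 if f is not Bochner integrable on D. *)
Definition bochner D f : X := xget 0 [set v | has_bochner D f v].

End bochner.

Section operators.
Context {R : realType} {X : completeNormedModType R[i]}.

(* The values of the underlying function outside of [dom] are irrelevant. *)
Record linop := LinOp {
  dom : set X ;
  linop_fun :> X -> X ;
  dom0 : dom 0 ;
  domP : forall (a : R[i]) x y, dom x -> dom y -> dom (a *: x + y) ;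
  linopP : forall (a : R[i]) x y, dom x -> dom y ->
    linop_fun (a *: x + y) = a *: linop_fun x + linop_fun y }.

Definition linop_of (f : {linear X -> X}) : linop :=
  @LinOp setT f I (fun _ _ _ _ _ => I) (fun a x y _ _ => linearP f a x y).

Definition closed_op (A : linop) :=
  closed [set p : X * X | dom A p.1 /\ p.2 = A p.1].

Definition densely_defined (A : linop) := dense (dom A).

Definition bounded_op (f : X -> X) :=
  exists M : R, forall x, `|f x| <= M%:C * `|x|.

Definition subop (l : R[i]) (A : linop) (x : X) : X := l *: x - A x.

(* For a closed operator, bijectivity of lambda - A from its domain onto the
   space already makes the inverse bounded. *)
Definition spectrum (A : linop) : set R[i] :=
  [set l | ~ set_bij (dom A) setT (subop l A)].

Definition point_spectrum (A : linop) : set R[i] :=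
  [set l | ~ set_inj (dom A) (subop l A)].

Definition approx_point_spectrum (A : linop) : set R[i] :=
  [set l | ~ set_inj (dom A) (subop l A) \/ ~ closed (subop l A @` dom A)].

Definition residual_spectrum (A : linop) : set R[i] :=
  [set l | ~ dense (subop l A @` dom A)].

End operators.
Arguments linop {R} X.

Section resolvent_families.
Context {R : realType} {X : completeNormedModType R[i]}.
Local Notation leb := (@lebesgue_measure R).

Definition conv_integrand (a : R) (f : R -> X) (t : R) : R -> X :=
  fun s => (g_ a (t - s))%:C *: f s.

(* The family is indexed by t > 0; [S t] is irrelevant for t <= 0. *)
Record generates (a b : R) (A : linop X) (S : R -> {linear X -> X}) : Prop := {
  gen_bounded : forall t : R, 0 < t -> bounded_op (S t) ;
  gen_cont : forall x (t : R), 0 < t -> {for t, continuous (fun s : R => S s x)} ;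
  gen_lim0 : forall x, ((g_ b t)^-1)%:C *: S t x @[t --> 0^'+] --> x ;
  gen_comm : forall (t : R) x, 0 < t -> dom A x ->
    dom A (S t x) /\ A (S t x) = S t (A x) ;
  gen_eq : forall x (t : R), 0 < t ->
    let f := conv_integrand a (fun s => S s x) t in
    let v := bochner leb `]0, t[ f in
    [/\ bochner_integrable leb `]0, t[ f, dom A v &
        S t x = (g_ b t)%:C *: x + A v] }.

Definition L1loc (f : R -> X) :=
  forall tau : R, 0 < tau -> bochner_integrable leb `]0, tau[ f.

Definition laplace_transformable (omega : R) (S : R -> {linear X -> X}) :=
  forall x (l : R[i]), omega < complex.Re l ->
    cvg (bochner leb `]0, tau[ (fun t : R => cexp (- l * t%:C) *: S t x)
         @[tau --> +oo]).

Definition classC (a b omega : R) (A : linop X) :=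
  exists S : R -> {linear X -> X},
    [/\ generates a b A S, forall x, L1loc (fun t => S t x) &
        laplace_transformable omega S].

End resolvent_families.

(* Main.v *)
Require Import Defs.
From mathcomp Require Import ring lra measurable_realfun.
Set Implicit Arguments.
Unset Strict Implicit.
Unset Printing Implicit Defensive.
Local Open Scope classical_set_scope.
Local Open Scope complex_scope.
Local Open Scope ring_scope.

(** Fix t > 0 and a complex number l, and put m := m^l_(alpha,beta)(t). The inclusions all
    follow from one operator B that satisfies

      (l - A) B x = m x - S(t) x for every x,
      B (l - A) x = m x - S(t) x for x in the domain of A.

    The second identity makes l - A injective whenever m - S(t) is, and the first one
    makes the range of l - A contain that of m - S(t); this settles the spectrum, the
    point spectrum and the residual spectrum. For the approximate point spectrum, suppose
    that m - S(t) is injective with closed range. By the closed graph theorem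
    (closed_graph) its inverse is bounded, and so is B, whose graph is closed because
    l - A is closed and injective. Hence l - A is bounded below, and its range is closed
    because A is (closed_range_transfer).

    B is the convolution of S with the scalar resolvent family of l. Expanding the latter
    in powers of l turns B x into the Neumann series of l^n J^(n+1) S x evaluated at t,
    where J is convolution with g_alpha (frac_int). The defining equation of the family
    says that A J S x = S x - g_beta x; since J commutes with the closed operator A
    (frac_int_closed) and J g_p = g_(alpha+p) (frac_int_kernel), it follows that
    A J^(n+1) S x = J^n S x - g_(n alpha+beta) x. Summing with weights l^n and using that A
    is closed yields the first identity (family_convolution_left), since the kernels sum
    to the Mittag-Leffler function (ml_series); the second one comes from
    A S(t) = S(t) A on the domain of A.

    The integrals in J are Bochner integrals of functions that are continuous on ]0, t[ and
    dominated by C s^(q-1) (t - s)^(p-1). For these the integral is the limit of Riemann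
    sums on the fixed grids k t / N with the two extreme cells left out
    (bochner_riemann). Consequently linearity, commutation with closed operators and
    changes of scale are checked on finite sums. The law J g_p = g_(alpha+p) is the
    Beta-Gamma identity (gamma_beta, g_convolution). It also shows that J maps functions
    bounded by C g_p to functions bounded by C g_(alpha+p) with the same C, so that the
    Neumann series converges by the growth of Gamma (kernel_geometric). *)

(** * The norm as a real number *)

Section real_norm.
Context {R : realType} {V : normedModType R[i]}.
Implicit Types (x y : V) (a : R[i]) (r : R).

(** The norm takes its values in R[i]; its real part carries the same information and
    is what real integration and the order tactics work with. *)
Definition nrm x : R := complex.Re `|x|.

Lemma nrmE x : (nrm x)%:C = `|x|.
Proof. by apply/eqP; rewrite eq_complex /nrm eqxx /= ger0_Im. Qed.

Lemma nrm_ge0 x : 0 <= nrm x.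
Proof. by rewrite -lecR nrmE normr_ge0. Qed.

Lemma nrm0 : nrm 0 = 0.
Proof. by apply/eqP; rewrite -(inj_eq (@complexI R)) nrmE normr0. Qed.

Lemma nrm0_eq0 x : nrm x = 0 -> x = 0.
Proof. by move=> x0; apply/eqP; rewrite -normr_eq0 -nrmE x0. Qed.

Lemma nrmN x : nrm (- x) = nrm x.
Proof. by rewrite /nrm normrN. Qed.

Lemma nrmBC x y : nrm (x - y) = nrm (y - x).
Proof. by rewrite -nrmN opprB. Qed.

Lemma nrmD x y : nrm (x + y) <= nrm x + nrm y.
Proof. by rewrite -lecR rmorphD /= !nrmE ler_normD. Qed.

Lemma nrmB x y : nrm (x - y) <= nrm x + nrm y.
Proof. by rewrite (le_trans (nrmD _ _)) ?nrmN. Qed.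

Lemma nrm_dist x y : `|nrm x - nrm y| <= nrm (x - y).
Proof.
rewrite ler_norml; apply/andP; split.
  by rewrite lerNl opprB lerBlDr nrmBC -[y in leLHS](subrK x) nrmD.
by rewrite lerBlDr -[x in leLHS](subrK y) nrmD.
Qed.

Lemma nrmZ a x : nrm (a *: x) = complex.Re `|a| * nrm x.
Proof.
apply: (@complexI R); rewrite rmorphM /= !nrmE normrZ; congr (_ * _).
Qed.

Lemma nrmZr r x : nrm (r%:C *: x) = `|r| * nrm x.
Proof. by rewrite nrmZ normc_def /= expr0n addr0 sqrtr_sqr. Qed.

Lemma nrm_cvgP T (F : set_system T) {FF : Filter F} (f : T -> V) l :
  f x @[x --> F] --> l <-> nrm (f x - l) @[x --> F] --> (0 : R).
Proof.
split=> [/cvgrPdist_lt fl|/cvgrPdist_lt fl]; apply/cvgrPdist_lt => e e0.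
  have /fl : 0 < e%:C by rewrite ltcR.
  by apply: filterS => x; rewrite sub0r normrN ger0_norm ?nrm_ge0// nrmBC -nrmE ltcR.
have e0' : 0 < complex.Re e by move: e0; rewrite ltcE => /andP[].
have eE : e = (complex.Re e)%:C by apply/eqP; rewrite eq_complex eqxx /= (ger0_Im (ltW e0)).
have := fl _ e0'; apply: filterS => x.
by rewrite sub0r normrN ger0_norm ?nrm_ge0// nrmBC [in X in _ -> X]eE -nrmE ltcR.
Qed.

Lemma cvg_nrm T (F : set_system T) {FF : Filter F} (f : T -> V) l :
  f x @[x --> F] --> l -> nrm (f x) @[x --> F] --> nrm l.
Proof.
move=> /nrm_cvgP /cvgrPdist_lt fl; apply/cvgrPdist_lt => e /fl.
apply: filterS => x; rewrite sub0r normrN ger0_norm ?nrm_ge0//.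
by apply: le_lt_trans; rewrite distrC nrm_dist.
Qed.

Lemma nrm_cvg_le (u : nat -> V) l (c : R) :
  u n @[n --> \oo] --> l -> (forall n, nrm (u n) <= c) -> nrm l <= c.
Proof.
move=> ul uc; have nl : nrm (u n) @[n --> \oo] --> nrm l by exact: cvg_nrm.
by rewrite -(cvg_lim (@Rhausdorff R) nl); apply: limr_le; [exact: cvgP nl|exact: nearW].
Qed.

Lemma closed_setP (D : set V) : closed D <->
  forall (u : nat -> V) l, (forall n, D (u n)) -> u n @[n --> \oo] --> l -> D l.
Proof.
split=> [cD u l Du ul|D_seq].
  by move: ul; apply: closed_cvg => //; apply: nearW.
move=> l cl.
have /choice[u uP] : forall n : nat, exists y, D y /\ nrm (y - l) < n.+1%:R^-1.
  move=> n.
  have n0 : 0 < (n.+1%:R^-1 : R)%:C by rewrite ltcR.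
  have [y [Dy]] := cl _ (nbhsx_ballx l _ n0).
  rewrite -ball_normE /= -nrmE ltcR => yl; exists y; split => //.
  by rewrite nrmBC.
apply: (D_seq u); first by move=> n; have [] := uP n.
apply/nrm_cvgP.
apply: (@squeeze_cvgr _ _ _ _ (fun=> 0) (fun n => n.+1%:R^-1)).
- by apply: nearW => n; rewrite nrm_ge0 ltW//; have [] := uP n.
- exact: cvg_cst.
- exact: cvg_harmonic.
Qed.

End real_norm.

Section complete.
Context {R : realType} {X : completeNormedModType R[i]}.

Lemma nrm_cauchy_cvg (u : nat -> X) :
  (forall e : R, 0 < e -> exists N, forall m n, (N <= m)%N -> (N <= n)%N ->
     nrm (u m - u n) <= e) -> cvgn u.
Proof.
move=> uC; apply/cauchy_cvgP/cauchy_ballP => e e0.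
have e0' : 0 < complex.Re e / 2 by rewrite divr_gt0//; move: e0; rewrite ltcE => /andP[].
have eE : e = (complex.Re e)%:C by apply/eqP; rewrite eq_complex eqxx /= (ger0_Im (ltW e0)).
have [N uN] := uC _ e0'.
exists (u @` [set n | (N <= n)%N], u @` [set n | (N <= n)%N]) => /=.
  by split; exists N => // n /= Nn; exists n.
move=> [x y] /= [[m /= Nm <-]] [n /= Nn <-].
rewrite -ball_normE /= -nrmE eE ltcR (le_lt_trans (uN _ _ Nm Nn))//.
by rewrite ltr_pdivrMr// ltr_pMr ?ltr1n//; move: e0'; rewrite pmulr_lgt0.
Qed.

(** The bound telescopes: 2 c / 2^m - 2 c / 2^(m+1) = c / 2^m pays for the term of
    index m. *)
Lemma geometric_series_bound (u : nat -> X) (c : R) :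
  (forall n, nrm (u n) <= c * 2^-1 ^+ n) ->
  forall m n, (m <= n)%N -> nrm (series u n - series u m) <= 2 * c * 2^-1 ^+ m.
Proof.
move=> uc m n /subnKC <-; move: (n - m)%N => k.
suff: nrm (series u (m + k)%N - series u m) <=
    2 * c * 2^-1 ^+ m - 2 * c * 2^-1 ^+ (m + k)%N.
  move=> /le_trans; apply; rewrite gerBl.
  rewrite mulr_ge0// ?mulr_ge0 ?exprn_ge0//.
  by have := le_trans (nrm_ge0 _) (uc 0%N); rewrite expr0 mulr1.
elim: k => [|k IH]; first by rewrite addn0 !subrr nrm0.
rewrite addnS seriesSr -addrA addrCA (le_trans (nrmD _ _))//.
rewrite (le_trans (lerD (uc _) IH))// exprS.
rewrite le_eqVlt; apply/orP; left; apply/eqP; by set q := (2^-1 ^+ _); field.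
Qed.

Lemma geometric_series_cvg (u : nat -> X) (c : R) :
  (forall n, nrm (u n) <= c * 2^-1 ^+ n) ->
  exists2 l, series u n @[n --> \oo] --> l & nrm l <= 2 * c.
Proof.
move=> uc; have ub := geometric_series_bound uc.
have cu : cvgn (series u).
  apply: nrm_cauchy_cvg => e e0.
  have : 2 * c * 2^-1 ^+ n @[n --> \oo] --> (0 : R).
    rewrite -[X in _ --> X](mulr0 (2 * c)); apply: cvgMl_tmp.
    by apply: cvg_expr; rewrite ger0_norm// invf_lt1// ltr1n.
  have e20 : 0 < e by [].
  move=> /cvgrPdist_le /(_ _ e20)[N _ HN]; exists N => m n.
  wlog mn : m n / (m <= n)%N => [hw Nm Nn|Nm _].
    by have [/hw|/ltnW/hw] := leqP m n; [exact|rewrite nrmBC; exact].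
  rewrite nrmBC (le_trans (ub _ _ mn))//.
  by have := HN _ Nm; rewrite sub0r normrN; apply: le_trans; rewrite ler_norm.
move: cu => /cvg_ex[l ul]; exists l => //.
apply: (nrm_cvg_le ul) => n; have := ub 0%N n (leq0n _).
by rewrite [series u 0%N]big_geq// subr0 expr0 mulr1.
Qed.

End complete.

(** * Closed graph theorem *)

Section closed_graph.
Context {R : realType} {X : completeNormedModType R[i]}.
Implicit Types (K : linop X) (x y : X).

Lemma domD K x y : dom K x -> dom K y -> dom K (x + y).
Proof. by move=> dx dy; rewrite -[x]scale1r; exact: domP. Qed.

Lemma domZ K (a : R[i]) x : dom K x -> dom K (a *: x).
Proof. by move=> dx; rewrite -[_ *: _]addr0; apply: domP => //; exact: dom0. Qed.

Lemma domN K x : dom K x -> dom K (- x).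
Proof. by move=> dx; rewrite -(scaleN1r x); exact: domZ. Qed.

Lemma domB K x y : dom K x -> dom K y -> dom K (x - y).
Proof. by move=> dx dy; apply: domD => //; exact: domN. Qed.

Lemma linop0 K : K 0 = 0.
Proof.
have := linopP (l := K) 1 (dom0 K) (dom0 K).
by rewrite !scale1r addr0 => /eqP; rewrite -subr_eq0 opprD addNKr oppr_eq0 => /eqP.
Qed.

Lemma linopD K x y : dom K x -> dom K y -> K (x + y) = K x + K y.
Proof. by move=> dx dy; have := linopP 1 dx dy; rewrite !scale1r. Qed.

Lemma linopZ K (a : R[i]) x : dom K x -> K (a *: x) = a *: K x.
Proof. by move=> dx; have := linopP a dx (dom0 K); rewrite linop0 !addr0. Qed.

Lemma linopB K x y : dom K x -> dom K y -> K (x - y) = K x - K y.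
Proof.
move=> dx dy; rewrite linopD//; last exact: domN.
by rewrite -(scaleN1r y) linopZ// scaleN1r.
Qed.

Lemma linop_sum K (I : eqType) (s : seq I) (f : I -> X) :
  (forall i, i \in s -> dom K (f i)) ->
  dom K (\sum_(i <- s) f i) /\ K (\sum_(i <- s) f i) = \sum_(i <- s) K (f i).
Proof.
elim: s => [|i s IH] ds; first by rewrite !big_nil linop0; split => //; exact: dom0.
have [d1 e1] : dom K (\sum_(j <- s) f j) /\
    K (\sum_(j <- s) f j) = \sum_(j <- s) K (f j).
  by apply: IH => j js; apply: ds; rewrite inE js orbT.
have d2 : dom K (f i) by apply: ds; rewrite inE eqxx.
by rewrite !big_cons linopD// e1; split => //; exact: domD.
Qed.

Lemma closed_opP K : closed_op K -> forall (u : nat -> X) x y,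
  (forall n, dom K (u n)) -> u n @[n --> \oo] --> x -> K (u n) @[n --> \oo] --> y ->
  dom K x /\ K x = y.
Proof.
move=> cK u x y du ux Ky.
have uK : (u n, K (u n)) @[n --> \oo] --> (x, y) by exact: cvg_pair.
have [/= dx ->] : [set p : X * X | dom K p.1 /\ p.2 = K p.1] (x, y).
  by move: uK; apply: closed_cvg => //; apply: nearW => n; have := du n.
by [].
Qed.

Variable K : linop X.
Hypothesis dom_closed : forall (u : nat -> X) x,
  (forall n, dom K (u n)) -> u n @[n --> \oo] --> x -> dom K x.
Hypothesis graph_closed : forall (u : nat -> X) x y,
  (forall n, dom K (u n)) -> u n @[n --> \oo] --> x -> K (u n) @[n --> \oo] --> y ->
  K x = y.

(* the closure, inside the domain, of the n-th sublevel set of nrm \o K *)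
Let F (c : R) x := forall e : R, 0 < e ->
  exists z, [/\ dom K z, nrm (x - z) < e & nrm (K z) <= c].

(* Baire's argument, carried out inside the domain: otherwise each sublevel set could
   be avoided by a ball nested in the previous one, and the limit of the centres would
   have no finite image norm *)
Let baire : exists n x0 r, [/\ dom K x0, 0 < r &
  forall x, dom K x -> nrm (x - x0) < r -> F n%:R x].
Proof.
apply: contrapT => H.
(* a state is a stage, a centre in the domain and a radius *)
pose state := {p : nat * (X * R) | dom K p.2.1 /\ 0 < p.2.2}.
have next : forall p : state, {q : state |
   [/\ (sval q).1 = (sval p).1.+1,
     nrm ((sval q).2.1 - (sval p).2.1) + (sval q).2.2 <= (sval p).2.2,
     (sval q).2.2 <= (sval p).2.2 / 2 &
     forall z, dom K z -> nrm ((sval q).2.1 - z) <= (sval q).2.2 ->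
       (sval p).1%:R < nrm (K z)]}.
  move=> [[n [x0 r]] /= [dx0 r0]]; apply: cid.
  have [x [dx xx0 nF]] : exists x, [/\ dom K x, nrm (x - x0) < r & ~ F n%:R x].
    apply: contrapT => nx; apply: H; exists n, x0, r; split => // x dx xx0.
    by apply: contrapT => nF; apply: nx; exists x.
  have [e [e0 eP]] : exists e : R, 0 < e /\ forall z, dom K z -> nrm (x - z) < e ->
      n%:R < nrm (K z).
    apply: contrapT => ne; apply: nF => e e0; apply: contrapT => nz; apply: ne.
    exists e; split => // z dz xz; rewrite ltNge; apply/negP => Kz.
    by apply: nz; exists z.
  pose d := Num.min (e / 2) (Num.min (r - nrm (x - x0)) (r / 2)).
  have d0 : 0 < d by rewrite !lt_min !divr_gt0//= subr_gt0 xx0.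
  exists (exist _ (n.+1, (x, d)) (conj dx d0)); split => //=.
  - by rewrite addrC -lerBrDr !ge_min lexx !orbT.
  - by rewrite !ge_min lexx !orbT.
  - move=> z dz /le_lt_trans xz; apply: eP => //; apply: xz.
    by rewrite gt_min ltr_pdivrMr// ltr_pMr// ltr1n.
have [f [f0 fS]] := dependent_choice next (exist _ (0%N, (0, 1)) (conj (dom0 K) ltr01)).
pose x n := (sval (f n)).2.1; pose r n := (sval (f n)).2.2.
have r0 n : 0 < r n by exact: (svalP (f n)).2.
have dx n : dom K (x n) by exact: (svalP (f n)).1.
have fn n : (sval (f n)).1 = n.
  by elim: n => [|n IH]; [rewrite f0|have [-> _ _ _] := fS n; rewrite IH].
have xr m k : nrm (x (m + k)%N - x m) <= r m - r (m + k)%N.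
  elim: k => [|k IH]; first by rewrite addn0 !subrr nrm0.
  have [_ + _ _] := fS (m + k)%N; rewrite -/(x _) -/(x _) -/(r _) -/(r _) -addnS => h.
  rewrite -(subrKA (x (m + k)%N)) (le_trans (nrmD _ _))//.
  by move: IH h; lra.
have rn n : r n <= 2^-1 ^+ n.
  elim: n => [|n IH]; first by rewrite /r f0.
  have [_ _ h _] := fS n; rewrite exprS mulrC (le_trans h)//.
  by rewrite ler_pM2r// invr_gt0.
have /cvg_ex[l xl] : cvgn x.
  apply: nrm_cauchy_cvg => e e0.
  have : 2^-1 ^+ n @[n --> \oo] --> (0 : R).
    by apply: cvg_expr; rewrite ger0_norm// invf_lt1// ltr1n.
  move=> /cvgrPdist_le /(_ _ e0)[N _ HN]; exists N => m n.
  wlog mn : m n / (m <= n)%N => [hw Nm Nn|Nm _].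
    by have [/hw|/ltnW/hw] := leqP m n; [exact|rewrite nrmBC; exact].
  rewrite nrmBC -(subnKC mn) (le_trans (xr _ _))//.
  rewrite (le_trans (y := r m))//; first by rewrite gerBl ltW.
  rewrite (le_trans (rn m))//.
  by have := HN _ Nm; rewrite sub0r normrN; apply: le_trans; rewrite ler_norm.
have dl : dom K l := dom_closed dx xl.
have lr m : nrm (x m - l) <= r m.
  rewrite nrmBC; apply: (@nrm_cvg_le _ _ (fun k => x (k + m)%N - x m)).
    by apply: cvgB; [rewrite (cvg_shiftn m)|exact: cvg_cst].
  by move=> k; rewrite addnC (le_trans (xr _ _))// gerBl ltW.
have Kl m : m%:R < nrm (K l).
  have [_ _ _ h] := fS m; rewrite -[in m%:R](fn m); apply: h => //.
  exact: lr.
have := Kl (Num.truncn (nrm (K l))).+1.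
by apply/negP; rewrite -leNgt ltW// truncnS_gt.
Qed.

(* every vector of the domain is, up to an arbitrary error, a vector whose image has
   comparable norm: subtract two approximations, of x0 + c x and of x0 *)
Let approx : exists2 C, 0 <= C & forall x e, dom K x -> 0 < e ->
  exists z, [/\ dom K z, nrm (x - z) < e & nrm (K z) <= C * nrm x].
Proof.
have [n [x0 [r [dx0 r0 FP]]]] := baire.
exists (4 * n%:R / r) => [|x e dx e0]; first by rewrite divr_ge0 ?mulr_ge0// ltW.
have [/nrm0_eq0 ->|/eqP xn0] := eqVneq (nrm x) 0.
  exists 0; split; first exact: dom0.
    by rewrite subrr nrm0.
  by rewrite linop0 nrm0 mulr0.
have x_gt0 : 0 < nrm x by rewrite lt_neqAle nrm_ge0 andbT; apply/eqP => /esym.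
pose c := r / (2 * nrm x).
have c0 : 0 < c by rewrite divr_gt0// mulr_gt0.
have e2 : 0 < e * c / 2 by rewrite divr_gt0// mulr_gt0.
have Fx0 : F n%:R x0 by apply: FP => //; rewrite subrr nrm0.
have Fy : F n%:R (x0 + c%:C *: x).
  apply: FP; first by apply: domD => //; exact: domZ.
  rewrite addrAC subrr add0r nrmZr gtr0_norm// /c.
  by rewrite invfM mulrA divfK ?gt_eqF// ltr_pdivrMr// ltr_pMr// ltr1n.
have [z1 [dz1 yz1 Kz1]] := Fy _ e2.
have [z2 [dz2 yz2 Kz2]] := Fx0 _ e2.
have dz : dom K (z1 - z2) by exact: domB.
exists ((c^-1)%:C *: (z1 - z2)); split; first exact: domZ.
  have -> : x - (c^-1)%:C *: (z1 - z2) =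
      (c^-1)%:C *: (((x0 + c%:C *: x) - z1) - (x0 - z2)).
    have -> : x0 + c%:C *: x - z1 - (x0 - z2) = c%:C *: x - (z1 - z2).
      rewrite !opprB [x0 + _]addrC -!addrA; congr (_ + _).
      by rewrite addrCA [x0 + _]addrC subrK addrC.
    by rewrite [RHS]scalerBr scalerA -rmorphM/= mulVf ?gt_eqF// scale1r.
  rewrite nrmZr gtr0_norm ?invr_gt0// mulrC ltr_pdivrMr//.
  by rewrite (le_lt_trans (nrmB _ _))// (splitr (e * c)) ltrD.
rewrite linopZ// linopB// nrmZr gtr0_norm ?invr_gt0// mulrC ler_pdivrMr//.
rewrite (le_trans (nrmB _ _))// (le_trans (lerD Kz1 Kz2))//.
rewrite le_eqVlt; apply/orP; left; apply/eqP.
by rewrite /c; field; rewrite !gt_eqF.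
Qed.

(** Successive approximation writes x as a series of vectors whose images decay
    geometrically; the sum of the images is K x because the graph is closed. The domain
    need not be the whole space: that lets the result apply to the inverse of an
    injective operator with closed range, where it plays the role of the open mapping
    theorem. *)
Lemma closed_graph : exists M : R, forall x, dom K x -> nrm (K x) <= M * nrm x.
Proof.
have [C C0 CP] := approx.
have /choice[g gP] : forall p : X * R, exists z, dom K p.1 -> 0 < p.2 ->
    [/\ dom K z, nrm (p.1 - z) < p.2 & nrm (K z) <= C * nrm p.1].
  move=> [x e] /=; have [dx|ndx] := pselect (dom K x); last by exists 0.
  have [e0|ne0] := pselect (0 < e); last by exists 0.
  by have [z zP] := CP _ _ dx e0; exists z.
exists (2 * C) => x dx.
have [/nrm0_eq0 ->|/eqP xn0] := eqVneq (nrm x) 0.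
  by rewrite linop0 nrm0 mulr0.
have x_gt0 : 0 < nrm x by rewrite lt_neqAle nrm_ge0 andbT; apply/eqP => /esym.
pose e n := nrm x * 2^-1 ^+ n.
have e0 n : 0 < e n by rewrite mulr_gt0// exprn_gt0// invr_gt0.
(* xs n is the error left after n steps, z n the correction chosen at step n *)
pose xs := fix f n := if n is n'.+1 then f n' - g (f n', e n) else x.
pose z n := g (xs n, e n.+1).
have xsP n : dom K (xs n) /\ nrm (xs n) <= e n.
  elim: n => [|n [dn IH]]; first by rewrite /e expr0 mulr1.
  have [dz xz _] := gP (xs n, e n.+1) dn (e0 _).
  by split => /=; [exact: domB|exact: ltW].
have dz n : dom K (z n) by have [] := gP (xs n, e n.+1) (xsP n).1 (e0 _).
have Kz n : nrm (K (z n)) <= (C * nrm x) * 2^-1 ^+ n.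
  have [_ _ h] := gP (xs n, e n.+1) (xsP n).1 (e0 _).
  by rewrite (le_trans h)// -mulrA ler_wpM2l//; exact: (xsP n).2.
have [l Kl nl] := geometric_series_cvg Kz.
have xsE n : x - xs n = \sum_(0 <= k < n) z k.
  elim: n => [|n IH]; first by rewrite big_geq// subrr.
  by rewrite big_nat_recr//= -IH opprB addrCA addrC.
have KE n : K (x - xs n) = series (fun k => K (z k)) n.
  by rewrite xsE; apply: (linop_sum _).2.
suff -> : K x = l by rewrite -mulrA.
apply: (graph_closed (u := fun n => x - xs n)).
- by move=> n; apply: domB => //; exact: (xsP n).1.
- apply/nrm_cvgP; apply: (@squeeze_cvgr _ _ _ _ (fun=> 0) e).
  + apply: nearW => n; rewrite nrm_ge0 addrAC subrr add0r nrmN.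
    exact: (xsP n).2.
  + exact: cvg_cst.
  + rewrite -[X in _ --> X](mulr0 (nrm x)); apply: cvgMl_tmp.
    by apply: cvg_expr; rewrite ger0_norm// invf_lt1// ltr1n.
- by under eq_fun do rewrite KE.
Qed.

End closed_graph.

(** * Gamma and Beta integrals *)

Section gamma_beta.
Context {R : realType}.
Local Notation leb := (@lebesgue_measure R).
Implicit Types (a b p q s t x : R).

(** The pushforward of Lebesgue measure under x |-> c x + d, scaled by c, agrees with
    Lebesgue measure on half-open intervals, hence on Borel sets. *)
Lemma integral_affine (c d : R) (F : R -> \bar R) : 0 < c ->
  measurable_fun setT F -> (forall x, 0 <= F x)%E ->
  (\int[leb]_x F x = c%:E * \int[leb]_x F (c * x + d)%R)%E.
Proof.
move=> c0 mF F0.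
pose phi (x : measurableTypeR R) : measurableTypeR R := c * x + d.
have mphi : measurable_fun setT phi.
  by apply: measurable_funD => //; exact: measurable_funM.
pose cn := NngNum (ltW c0).
have -> : (\int[leb]_x F (c * x + d)%R)%E =
    (\int[leb]_(x in phi @^-1` setT) (F \o phi) x)%E by rewrite preimage_setT.
rewrite -(ge0_integral_pushforward mphi)// -[c in c%:E]/(cn%:num).
rewrite -ge0_integral_mscale//; apply: eq_measure_integral => A mA _.
apply: lebesgue_measure_unique => //= X /ocitvP[->|[[u v] /= uv ->]].
  by rewrite !measure0.
rewrite /mscale /= /pushforward /=.
have -> : phi @^-1` `]u, v]%classic = `](u - d) / c, (v - d) / c]%classic.
  apply/seteqP; split => x /=; rewrite !in_itv /= /phi;
  by rewrite ltr_pdivrMr// ler_pdivlMr// ltrBlDr lerBrDr mulrC.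
rewrite !lebesgue_measure_itv /= !lte_fin uv ltr_pM2r ?invr_gt0// ltrD2r uv.
by rewrite -!EFinD -EFinM; congr EFin; field; rewrite gt_eqF.
Qed.


(* the Gamma integrand, extended by zero *)
Let phi a x := if 0 < x then x `^ (a - 1) * expR (- x) else 0.

Let phi_ge0 a x : 0 <= phi a x.
Proof. by rewrite /phi; case: ifP => // _; rewrite mulr_ge0 ?powR_ge0 ?expR_ge0. Qed.

Let mphi a : measurable_fun setT (phi a).
Proof.
apply: measurable_fun_if => //.
- exact: measurable_fun_ltr.
- apply: measurable_funTS; apply: measurable_funM; first exact: measurable_powR.
  by apply: measurableT_comp => //; exact: measurable_oppr.
Qed.

Definition gamma_integral a : \bar R :=
  (\int[leb]_(t in `]0%R, +oo[) (t `^ (a - 1) * expR (- t))%:E)%E.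

Let gamma_integralE a : gamma_integral a = (\int[leb]_x (phi a x)%:E)%E.
Proof.
rewrite /gamma_integral integral_mkcond; apply: eq_integral => x _.
by rewrite patchE mem_setE in_itv /= andbT /phi; case: ifP.
Qed.

Definition beta_integral a b : \bar R :=
  (\int[leb]_(s in `]0%R, 1%R[) (s `^ (a - 1) * (1 - s) `^ (b - 1))%:E)%E.

(* the Beta integrand on ]0, t[, extended by zero *)
Let psi a b t s := if (0 < s < t) then s `^ (a - 1) * (t - s) `^ (b - 1) else 0.

Let psi_ge0 a b t s : 0 <= psi a b t s.
Proof. by rewrite /psi; case: ifP => // _; rewrite mulr_ge0 ?powR_ge0. Qed.

Let mpsi a b t : measurable_fun setT (psi a b t).
Proof.
apply: measurable_fun_if => //.
- by apply: measurable_and; exact: measurable_fun_ltr.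
- apply: measurable_funTS; apply: measurable_funM; first exact: measurable_powR.
  apply: (@measurableT_comp _ _ _ _ _ _ (fun x => x `^ (b - 1))).
    exact: measurable_powR.
  exact: measurable_funB.
Qed.

Let integral_psi a b t : (\int[leb]_(s in `]0%R, t[) (s `^ (a - 1) * (t - s) `^ (b - 1))%:E
  = \int[leb]_s (psi a b t s)%:E)%E.
Proof.
rewrite integral_mkcond; apply: eq_integral => x _.
by rewrite patchE mem_setE in_itv /= /psi; case: ifP.
Qed.

Let psi_scale a b t s : 0 < t ->
  psi a b t (t * s) = t `^ (a + b - 2) * psi a b 1 s.
Proof.
move=> t0; rewrite /psi pmulr_rgt0// gtr_pMr//.
case: ifPn => [/andP[s0 s1]|]; last by rewrite mulr0.
rewrite (_ : t - t * s = t * (1 - s)); last by ring.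
rewrite !powRM ?ltW// ?subr_gt0//.
have -> : t `^ (a + b - 2) = t `^ (a - 1) * t `^ (b - 1).
  by rewrite -powRD ?(lt0r_neq0 t0) ?implybT//; congr (_ `^ _); ring.
ring.
Qed.

Lemma integral_convolution a b t : 0 < t ->
  (\int[leb]_(s in `]0%R, t[) (s `^ (a - 1) * (t - s) `^ (b - 1))%:E
  = (t `^ (a + b - 1))%:E * beta_integral a b)%E.
Proof.
move=> t0; rewrite integral_psi /beta_integral integral_psi.
have mF : measurable_fun setT (fun s => (psi a b t s)%:E) by apply/measurable_EFinP.
have F0 s : (0 <= (psi a b t s)%:E)%E by rewrite lee_fin.
rewrite (integral_affine 0 t0 mF F0).
under eq_integral do rewrite addr0 psi_scale// EFinM.
rewrite ge0_integralZl_EFin ?powR_ge0//; last 2 first.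
- by move=> s _; rewrite lee_fin.
- by apply/measurable_EFinP; exact: mpsi.
rewrite muleA -EFinM; congr (_%:E * _)%E.
rewrite -[X in X * _](powRr1 (ltW t0)) -powRD ?(lt0r_neq0 t0) ?implybT//.
by congr (_ `^ _); ring.
Qed.

(** Write the product as an integral over x of phi a x times the integral over u of
    phi b (u - x), and exchange the order. For fixed u the exponentials combine to exp (- u)
    and the rest is a Beta integral over ]0, u[, which scales like u^(a+b-1). *)
Lemma gamma_beta a b :
  (gamma_integral a * gamma_integral b = gamma_integral (a + b) * beta_integral a b)%E.
Proof.
have mphiE c : measurable_fun setT (EFin \o phi c) by apply/measurable_EFinP.
pose h (z : R * R) := (phi a z.1 * phi b (z.2 - z.1))%:E.
have mh : measurable_fun setT h.
  apply/measurable_EFinP; apply: measurable_funM.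
    exact: measurableT_comp (mphi a) measurable_fst.
  apply: (measurableT_comp (mphi b)).
  by apply: measurable_funB; [exact: measurable_snd|exact: measurable_fst].
have h0 z : (0 <= h z)%E by rewrite lee_fin mulr_ge0.
have := @fubini_tonelli _ _ _ _ R leb leb _ mh h0.
rewrite {1}/h /=.
under eq_integral => x _.
  under eq_integral do rewrite EFinM.
  rewrite ge0_integralZl_EFin//; last 2 first.
  - by move=> u _; rewrite lee_fin.
  - apply/measurable_EFinP; apply: (measurableT_comp (mphi b)).
    exact: measurable_funB.
  have -> : (\int[leb]_u (phi b (u - x)%R)%:E = gamma_integral b)%E.
    rewrite gamma_integralE [RHS](@integral_affine 1 (- x))// ?mul1e.
    - by apply: eq_integral => u _; rewrite mul1r.
    - exact: mphiE.
    - by move=> u; rewrite lee_fin.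
  over.
rewrite (@ge0_integralZr _ _ _ leb _ measurableT _ (mphiE a))//; last 2 first.
- by move=> x _; rewrite lee_fin.
- by rewrite gamma_integralE; apply: integral_ge0 => x _; rewrite lee_fin.
rewrite -gamma_integralE => ->.
transitivity (\int[leb]_u ((phi (a + b) u)%:E * beta_integral a b))%E; last first.
  rewrite (@ge0_integralZr _ _ _ leb _ measurableT _ (mphiE (a + b)))// ?gamma_integralE//.
  - by move=> x _; rewrite lee_fin.
  - by apply: integral_ge0 => x _; rewrite lee_fin mulr_ge0 ?powR_ge0.
apply: eq_integral => u _; rewrite /h /=.
have [u0|u0] := leP u 0.
  rewrite [in RHS]/phi ltNge u0 /= mul0e; apply: integral0_eq => x _.
  rewrite /phi subr_gt0; case: ifP => x0; last by rewrite mul0r.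
  by rewrite ltNge (le_trans u0 (ltW x0)) /= mulr0.
transitivity (\int[leb]_x ((expR (- u))%:E * (psi a b u x)%:E))%E.
  apply: eq_integral => x _; rewrite -EFinM; congr EFin.
  rewrite /phi /psi subr_gt0; case: ltP => x0 /=; last by rewrite !(mul0r, mulr0).
  case: ifP => xu; last by rewrite !mulr0.
  rewrite (_ : - u = - x + - (u - x)); last by ring.
  by rewrite expRD; ring.
rewrite ge0_integralZl_EFin ?expR_ge0//; last 2 first.
- by move=> s _; rewrite lee_fin.
- by apply/measurable_EFinP; exact: mpsi.
rewrite -integral_psi integral_convolution// muleA -EFinM /phi u0.
by rewrite mulrC.
Qed.


(* the integral of t^(a-1) over [e, 1] is (1 - e^a) / a *)
Let integral_powR_cc a e : 0 < a -> 0 < e < 1 ->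
  (\int[leb]_(t in `[e, 1%R]) (t `^ (a - 1))%:E <= (a^-1)%:E)%E.
Proof.
move=> a0 /andP[e0 e1].
pose F t := a^-1 * t `^ a.
have dF x : 0 < x -> is_derive x 1 F (x `^ (a - 1)).
  move=> x0; have xin : x \in `]0, +oo[ by rewrite in_itv /= x0.
  have -> : x `^ (a - 1) = a^-1 *: (a * x `^ (a - 1)).
    by rewrite scalerA mulVf ?gt_eqF// scale1r.
  rewrite -(powR_derive1 a xin); apply: is_deriveZ.
  by rewrite derive1E; apply/derivableP; exact: derivable_powR.
have cF x : 0 < x -> {for x, continuous F}.
  move=> x0; have [dFx _] := dF _ x0.
  by apply: differentiable_continuous; exact/derivable1_diffP.
have cf x : 0 < x -> {for x, continuous (fun t : R => t `^ (a - 1))}.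
  move=> x0; have xin : x \in `]0, +oo[ by rewrite in_itv /= x0.
  apply: differentiable_continuous; apply/derivable1_diffP.
  exact: derivable_powR.
have := @continuous_FTC2 _ (fun t => t `^ (a - 1)) F e 1 e1.
rewrite /= => -> //.
- rewrite -EFinB lee_fin /F powR1 mulr1 lerBlDr lerDl mulr_ge0 ?powR_ge0//.
  by rewrite invr_ge0 ltW.
- apply: continuous_in_subspaceT => x; rewrite inE /= in_itv /= => /andP[ex _].
  by apply: cf; exact: lt_le_trans ex.
- split.
  + move=> x; rewrite in_itv /= => /andP[ex _].
    by have [] := dF x (lt_trans e0 ex).
  + by apply: cvg_at_right_filter; exact: cF.
  + by apply: cvg_at_left_filter; exact: cF.
- move=> x; rewrite in_itv /= => /andP[ex _].
  by rewrite derive1E; have [_ ->] := dF x (lt_trans e0 ex).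
Qed.

Let integral_powR_oc a : 0 < a ->
  (\int[leb]_(t in `]0%R, 1%R]) (t `^ (a - 1))%:E <= (a^-1)%:E)%E.
Proof.
move=> a0; pose D (n : nat) : set R := `[(n.+2%:R)^-1, 1]%classic.
have DE : `]0, 1]%classic = \bigcup_n D n.
  apply/seteqP; split => [x|x [n _]]; rewrite /D /= !in_itv /=.
    move=> /andP[x0 x1]; exists (Num.truncn x^-1) => //=; rewrite in_itv /= x1 andbT.
    rewrite invf_ple ?posrE//; apply: (le_trans (ltW (truncnS_gt _))).
    by rewrite ler_nat.
  by move=> /andP[nx ->]; rewrite andbT (lt_le_trans _ nx)// invr_gt0.
rewrite DE; have : (\int[leb]_(t in D n) (t `^ (a - 1))%:E)%E @[n --> \oo] -->
    (\int[leb]_(t in \bigcup_n D n) (t `^ (a - 1))%:E)%E.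
  apply: ge0_nondecreasing_set_cvg_integral.
  - move=> m n mn; apply/subsetPset => x; rewrite /D /= !in_itv /= => /andP[mx ->].
    by rewrite andbT (le_trans _ mx)// lef_pV2 ?posrE// ler_nat !ltnS.
  - by move=> n; exact: measurable_itv.
  - move=> n; apply: measurable_funTS; apply/measurable_EFinP.
    exact: measurable_powR.
  - by move=> n x _; rewrite lee_fin powR_ge0.
move=> cvgD; rewrite -(cvg_lim _ cvgD)//; apply: lime_le; first exact: cvgP cvgD.
apply: nearW => n; apply: integral_powR_cc => //.
by rewrite invr_gt0 ltr0n /= invf_lt1// ltr1n.
Qed.

(* ln y < y at y = t / (2 r) gives r ln t <= t / 2 + r ln (2 r) *)
Let powR_le_exp r : exists2 C : R, 0 <= C & forall t, 1 <= t -> t `^ r <= C * expR (t / 2).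
Proof.
wlog r0 : r / 0 < r => [hw|].
  have [r0|r0] := ltP 0 r; first exact: hw.
  have [C C0 HC] := hw 1 ltr01; exists C => // t t1.
  by rewrite (le_trans _ (HC t t1))// ler_powR// (le_trans r0).
exists (expR (r * ln (2 * r))); first exact: expR_ge0.
move=> t t1; have t0 : 0 < t by exact: lt_le_trans t1.
rewrite /powR gt_eqF// -expRD ler_expR.
have c0 : 0 < 2 * r by rewrite mulr_gt0.
have /ln_sublinear /ltW : 0 < t / (2 * r) by rewrite divr_gt0.
rewrite lnM ?posrE ?invr_gt0// lnV ?posrE// lerBlDr -(ler_pM2l r0) => /le_trans; apply.
rewrite mulrDr addrC lerD2l le_eqVlt; apply/orP; left; apply/eqP.
by field; rewrite gt_eqF.
Qed.

Lemma gamma_integral_lty a : 0 < a -> (gamma_integral a < +oo)%E.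
Proof.
move=> a0; have mf c : measurable_fun setT (fun t => t `^ (a - 1) * expR (- (c * t))).
  apply: measurable_funM; first exact: measurable_powR.
  by apply: measurableT_comp => //; apply: measurableT_comp.
have := mf 1; under eq_fun do rewrite mul1r; move=> {}mf.
rewrite /gamma_integral (_ : `]0, +oo[%classic = `]0, 1] `|` `]1, +oo[); last first.
  apply/seteqP; split => x /=; rewrite !in_itv /= ?andbT.
    by move=> x0; have [x1|x1] := leP x 1; [left|right]; rewrite ?x0 // andbT.
  by move=> [/andP[]|]//; apply: lt_trans.
rewrite ge0_integral_setU//=; last 3 first.
- by apply: measurable_funTS; apply/measurable_EFinP.
- by move=> x _; rewrite lee_fin mulr_ge0 ?powR_ge0 ?expR_ge0.
- by rewrite disj_set2E; apply/eqP; rewrite -subset0 => x [] /=;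
    rewrite !in_itv /= andbT => /andP[_ /le_lt_trans h] /h; rewrite ltxx.
apply: lte_add_pinfty.
  apply: (@le_lt_trans _ _ (a^-1)%:E); last by rewrite ltry.
  apply: le_trans (integral_powR_oc a0); apply: ge0_le_integral => //.
  - by move=> x _; rewrite lee_fin mulr_ge0 ?powR_ge0 ?expR_ge0.
  - by apply: measurable_funTS; apply/measurable_EFinP.
  - by apply: measurable_funTS; apply/measurable_EFinP; exact: measurable_powR.
  - move=> x /=; rewrite in_itv /= => /andP[x0 _]; rewrite lee_fin ler_piMr ?powR_ge0//.
    by rewrite -expR0 ler_expR lerNl oppr0 ltW.
have [C C0 HC] := powR_le_exp (a - 1).
have h2 : 0 < 2^-1 :> R by rewrite invr_gt0.
apply: (@le_lt_trans _ _ (\int[leb]_x ((2 * C)%:E * (exponential_pdf 2^-1 x)%:E)))%E;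
  last first.
  rewrite ge0_integralZl_EFin ?mulr_ge0//; last 2 first.
  - by move=> x _; rewrite lee_fin exponential_pdf_ge0// ltW.
  - by apply/measurable_EFinP; exact: measurable_exponential_pdf.
  by rewrite integral_exponential_pdf// mule1 ltry.
apply: (@le_trans _ _ (\int[leb]_(x in `]1%R, +oo[)
    ((2 * C)%:E * (exponential_pdf 2^-1 x)%:E)))%E; last first.
  apply: ge0_subset_integral => //.
  - apply: measurable_funeM; apply/measurable_EFinP.
    exact: measurable_exponential_pdf.
  - by move=> x _; rewrite -EFinM lee_fin !mulr_ge0 ?exponential_pdf_ge0// ltW.
apply: ge0_le_integral => //.
- by move=> x _; rewrite lee_fin mulr_ge0 ?powR_ge0 ?expR_ge0.
- by apply: measurable_funTS; apply/measurable_EFinP.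
- apply: measurable_funTS; apply: measurable_funeM; apply/measurable_EFinP.
  exact: measurable_exponential_pdf.
- move=> x /=; rewrite in_itv /= andbT => x1.
  have x0 : 0 < x by exact: lt_trans x1.
  rewrite -EFinM lee_fin exponential_pdfE ?(ltW x0)//.
  rewrite (le_trans (ler_wpM2r (expR_ge0 _) (HC x (ltW x1))))//.
  rewrite -mulrA -expRD le_eqVlt; apply/orP; left; apply/eqP.
  rewrite (_ : x / 2 + - x = - 2^-1 * x); last by field.
  by field.
Qed.

Lemma gamma_integral_ge K a : 0 < K -> 0 < a ->
  ((K `^ a * expR (- (K + 1)) / (K + 1))%:E <= gamma_integral a)%E.
Proof.
move=> K0 a0; have K10 : 0 < K + 1 by rewrite addr_gt0.
have mf : measurable_fun setT (fun t => (t `^ (a - 1) * expR (- t))%:E).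
  apply/measurable_EFinP; apply: measurable_funM; first exact: measurable_powR.
  by apply: measurableT_comp => //; exact: measurable_oppr.
apply: (@le_trans _ _ (\int[leb]_(t in `]K, (K + 1)%R[) (t `^ (a - 1) * expR (- t))%:E)%E);
  last first.
  apply: ge0_subset_integral => //.
  - exact: measurable_funTS mf.
  - by move=> x _; rewrite lee_fin mulr_ge0 ?powR_ge0 ?expR_ge0.
  - by move=> x /=; rewrite !in_itv /= andbT => /andP[/(lt_trans K0)].
apply: (@le_trans _ _ (\int[leb]_(t in `]K, (K + 1)%R[)
    (cst (K `^ a * expR (- (K + 1)) / (K + 1))%:E t))%E).
  rewrite integral_cst//= lebesgue_measure_itv /= lte_fin ltrDl ltr01.
  by rewrite -EFinB addrAC subrr add0r mule1.
apply: ge0_le_integral => //.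
- by move=> x _; rewrite lee_fin !mulr_ge0 ?powR_ge0 ?expR_ge0 ?invr_ge0// ltW.
- exact: measurable_funTS mf.
- move=> x /=; rewrite in_itv /= => /andP[Kx xK]; have x0 := lt_trans K0 Kx.
  rewrite lee_fin mulrAC ler_pM ?divr_ge0 ?powR_ge0 ?expR_ge0 ?(ltW K10)//.
    rewrite ler_pdivrMr// (@le_trans _ _ (x `^ a))//.
      by rewrite ge0_ler_powR ?nnegrE ?ltW.
    by rewrite -mulr_powRB1 ?(ltW x0)// mulrC ler_wpM2l ?powR_ge0 ?ltW.
  by rewrite ler_expR lerN2 ltW.
Qed.

Lemma gamma_integral_fin_num a : 0 < a -> gamma_integral a \is a fin_num.
Proof.
move=> a0; rewrite ge0_fin_numE; first exact: gamma_integral_lty.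
by apply: integral_ge0 => x _; rewrite lee_fin mulr_ge0 ?powR_ge0 ?expR_ge0.
Qed.

Lemma GammaE a : 0 < a -> gamma_integral a = (Gamma a)%:E.
Proof. by move=> a0; rewrite -(fineK (gamma_integral_fin_num a0)). Qed.

(** On [K, K + 1] the integrand is at least K^a exp (- (K + 1)) / (K + 1). The base K is
    free, so that Gamma outgrows every geometric sequence and the Mittag-Leffler series
    converges everywhere. *)
Lemma Gamma_ge K a : 0 < K -> 0 < a ->
  K `^ a * expR (- (K + 1)) / (K + 1) <= Gamma a.
Proof. by move=> K0 a0; rewrite -lee_fin -GammaE// gamma_integral_ge. Qed.

Lemma Gamma_gt0 a : 0 < a -> 0 < Gamma a.
Proof.
move=> a0; apply: lt_le_trans (Gamma_ge ltr01 a0).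
by rewrite divr_gt0// mulr_gt0// ?expR_gt0// powR_gt0.
Qed.

Lemma g_gt0 a t : 0 < a -> 0 < t -> 0 < g_ a t.
Proof. by move=> a0 t0; rewrite divr_gt0// ?Gamma_gt0// powR_gt0. Qed.

(** The semigroup law of the kernels under convolution; it turns the iterated fractional
    integrals of the kernels into the terms of the Mittag-Leffler series. *)
Lemma g_convolution p q t : 0 < p -> 0 < q -> 0 < t ->
  (\int[leb]_(s in `]0%R, t[) (g_ p (t - s) * g_ q s)%:E = (g_ (p + q) t)%:E)%E.
Proof.
move=> p0 q0 t0; have Gp := Gamma_gt0 p0; have Gq := Gamma_gt0 q0.
have Gpq : 0 < Gamma (p + q) by rewrite Gamma_gt0// addr_gt0.
transitivity (\int[leb]_(s in `]0%R, t[) (((Gamma p * Gamma q)^-1)%:E *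
    (s `^ (q - 1) * (t - s) `^ (p - 1))%:E))%E.
  apply: eq_integral => s _; rewrite -EFinM; congr EFin.
  by rewrite /g_ mulrACA -invfM mulrC [_ `^ (p - 1) * _]mulrC.
rewrite ge0_integralZl_EFin; last 4 first.
- by [].
- by move=> s _; rewrite lee_fin mulr_ge0 ?powR_ge0.
- apply/measurable_EFinP; apply: measurable_funM.
    by apply: measurable_funTS; exact: measurable_powR.
  apply: measurable_funTS; apply: (@measurableT_comp _ _ _ _ _ _ (fun x => x `^ (p - 1))).
    exact: measurable_powR.
  exact: measurable_funB.
- by rewrite invr_ge0; exact: ltW (mulr_gt0 Gp Gq).
rewrite integral_convolution//.
have := gamma_beta q p; rewrite !GammaE ?addr_gt0// [q + p]addrC => bE.
suff -> : beta_integral q p = (Gamma p * Gamma q / Gamma (p + q))%:E.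
  have alg (x y z : R) : y != 0 -> z != 0 -> y^-1 * (x * (y / z)) = x / z.
    by move=> y0 z0; field; rewrite y0 z0.
  rewrite -!EFinM; congr EFin; apply: alg.
    exact: lt0r_neq0 (mulr_gt0 Gp Gq).
  exact: lt0r_neq0.
have -> : beta_integral q p =
    ((Gamma (p + q))^-1%:E * ((Gamma (p + q))%:E * beta_integral q p))%E.
  by rewrite muleA -EFinM mulVf ?gt_eqF// mul1e.
by rewrite -bE -!EFinM; congr EFin; ring.
Qed.

End gamma_beta.

(** * Step functions and uniqueness of the Bochner integral *)

Section step_functions.
Context d (T : measurableType d) (R : realType).
Variables (mu : {measure set T -> \bar R}) (X : completeNormedModType R[i]).
Implicit Types (s : seq (set T * X)) (D : set T) (f h : T -> X) (c : X).

Lemma step_fun_cons p s t :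
  step_fun (p :: s) t = (\1_(p.1) t : R)%:C *: p.2 + step_fun s t.
Proof. by rewrite /step_fun big_cons. Qed.

Lemma step_int_cons D p s :
  step_int mu D (p :: s) = (fine (mu (p.1 `&` D)))%:C *: p.2 + step_int mu D s.
Proof. by rewrite /step_int big_cons. Qed.

Lemma step_valid_cons p s : step_valid mu (p :: s) ->
  [/\ measurable p.1, (mu p.1 < +oo)%E & step_valid mu s].
Proof.
move=> ps; have [|mp fp] := ps p; first by rewrite inE eqxx.
by split => // q qs; apply: ps; rewrite inE qs orbT.
Qed.

(** A substitute for strong measurability that is all the L1 estimates need; it is
    stable under adding step functions, and it holds for continuous functions. *)
Definition nrm_measurable D f := forall c, measurable_fun D (fun t => nrm (f t + c)).

Lemma nrm_measurable_cst D c : nrm_measurable D (fun=> c).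
Proof. by move=> c'; exact: measurable_cst. Qed.

Lemma nrm_measurable_step D f s : measurable D -> step_valid mu s ->
  nrm_measurable D f -> measurable_fun D (fun t => nrm (f t + step_fun s t)).
Proof.
move=> mD vs mf; suff : nrm_measurable D (fun t => f t + step_fun s t).
  by move=> /(_ 0); under eq_fun do rewrite addr0.
elim: s vs => [_ c|p s IH /step_valid_cons[mp _ vs] c].
  by under eq_fun do rewrite /step_fun big_nil addr0; exact: mf.
have -> : (fun t => nrm (f t + step_fun (p :: s) t + c)) =
  (fun t => if t \in p.1 then nrm (f t + step_fun s t + (p.2 + c))
            else nrm (f t + step_fun s t + c)).
  apply/funext => t; rewrite step_fun_cons indicE; case: ifP => _ /=.
    by rewrite scale1r; congr nrm; rewrite [p.2 + step_fun s t]addrC !addrA.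
  by rewrite scale0r add0r.
apply: measurable_fun_if => //.
- apply: (measurable_fun_bool true).
  rewrite (_ : _ @^-1` _ = p.1); first exact: measurableI.
  by apply/seteqP; split => x /=; [move=> /set_mem|move=> /mem_set].
- by apply: measurable_funS (IH vs _) => //; exact: subIsetl.
- by apply: measurable_funS (IH vs _) => //; exact: subIsetl.
Qed.

Definition step_opp s := [seq (p.1, - p.2) | p <- s].

Lemma step_fun_opp s t : step_fun (step_opp s) t = - step_fun s t.
Proof.
by rewrite /step_fun big_map /= -sumrN; apply: eq_bigr => p _; rewrite scalerN.
Qed.

Lemma step_fun_cat s s' t : step_fun (s ++ s') t = step_fun s t + step_fun s' t.
Proof. by rewrite /step_fun big_cat. Qed.

Lemma step_valid_opp s : step_valid mu s -> step_valid mu (step_opp s).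
Proof. by move=> vs p /mapP[q /vs vq ->]. Qed.

Lemma step_valid_cat s s' : step_valid mu s -> step_valid mu s' ->
  step_valid mu (s ++ s').
Proof. by move=> vs vs' p; rewrite mem_cat => /orP[/vs|/vs']. Qed.

Lemma nrm_measurable_stepB D f s : measurable D -> step_valid mu s ->
  nrm_measurable D f -> measurable_fun D (fun t => nrm (f t - step_fun s t)).
Proof.
move=> mD vs mf; have := nrm_measurable_step mD (step_valid_opp vs) mf.
by under eq_fun do rewrite step_fun_opp.
Qed.

Lemma nrm_measurable_stepBB D s s' : measurable D -> step_valid mu s ->
  step_valid mu s' -> measurable_fun D (fun t => nrm (step_fun s t - step_fun s' t)).
Proof.
move=> mD vs vs'; apply: nrm_measurable_stepB => // c.
have := nrm_measurable_step mD vs (@nrm_measurable_cst D c).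
by apply: eq_measurable_fun => t _; rewrite addrC.
Qed.

Lemma nrm_measurable_const_step D s c : measurable D -> step_valid mu s ->
  measurable_fun D (fun t => nrm (c + step_fun s t)).
Proof. by move=> mD vs; apply: nrm_measurable_step => //; exact: nrm_measurable_cst. Qed.

Lemma step_int_split D E s : measurable D -> (mu D < +oo)%E -> measurable E ->
  step_valid mu s ->
  step_int mu D s = step_int mu (D `&` E) s + step_int mu (D `\` E) s.
Proof.
move=> mD fD mE vs; rewrite /step_int -big_split /=; apply: eq_big_seq => p ps.
have [mp _] := vs p ps.
rewrite -scalerDl -rmorphD /= -fineD.
- congr ((fine _)%:C *: _); rewrite -measureU.
  + by rewrite -setIUr setUIDK.
  + by apply: measurableI => //; exact: measurableI.
  + by apply: measurableI => //; exact: measurableD.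
  + by rewrite -subset0 => x [[_ [_ Ex]] [_ [_ /(_ Ex)]]].
- rewrite ge0_fin_numE//; apply: le_lt_trans fD; apply: le_measure; rewrite ?inE//.
    by apply: measurableI => //; exact: measurableI.
  by move=> x [_ []].
- rewrite ge0_fin_numE//; apply: le_lt_trans fD; apply: le_measure; rewrite ?inE//.
    by apply: measurableI => //; exact: measurableD.
  by move=> x [_ []].
Qed.

(** When the values are nonnegative multiples of one vector there is no cancellation, and
    the right-hand side is the norm of the step integral; this gives lower bounds for the
    norm of a Bochner integral. *)
Lemma integral_nrm_step D s : measurable D -> (mu D < +oo)%E -> step_valid mu s ->
  (\int[mu]_(t in D) (nrm (step_fun s t))%:E <=
   (\sum_(p <- s) fine (mu (p.1 `&` D)) * nrm p.2)%:E)%E.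
Proof.
move=> mD fD; elim: s => [_|p s IH ps].
  by rewrite big_nil; under eq_integral do rewrite /step_fun big_nil nrm0; rewrite integral0.
have [mp _ vs] := step_valid_cons ps.
have mstep (u : seq (set T * X)) : step_valid mu u ->
    measurable_fun D (fun t => nrm (step_fun u t)).
  move=> vu; have := nrm_measurable_const_step 0 mD vu.
  by under eq_fun do rewrite add0r.
have fpD : (mu (p.1 `&` D) < +oo)%E.
  by apply: le_lt_trans fD; apply: le_measure; rewrite ?inE//; exact: measurableI.
have m1 : measurable_fun D (fun t => (nrm p.2)%:E * (\1_(p.1) t)%:E)%E.
  apply: measurable_funeM; apply/measurable_EFinP.
  by apply: measurable_funTS; exact: measurable_indic.
rewrite big_cons EFinD; apply: le_trans (leeD (lexx _) (IH vs)).
have -> : (fine (mu (p.1 `&` D)) * nrm p.2)%:E =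
    (\int[mu]_(t in D) ((nrm p.2)%:E * (\1_(p.1) t)%:E))%E.
  rewrite ge0_integralZl_EFin ?nrm_ge0//; last first.
    by apply/measurable_EFinP; apply: measurable_funTS; exact: measurable_indic.
  rewrite integral_indic// EFinM fineK; first by rewrite muleC.
  by rewrite ge0_fin_numE.
rewrite -ge0_integralD//; last 2 first.
- by move=> t _; rewrite lee_fin nrm_ge0.
- by apply/measurable_EFinP; exact: mstep.
apply: ge0_le_integral => //.
- by move=> t _; rewrite lee_fin nrm_ge0.
- by apply/measurable_EFinP; exact: mstep.
- by apply: emeasurable_funD => //; apply/measurable_EFinP; exact: mstep.
- move=> t _; rewrite -EFinM -EFinD lee_fin step_fun_cons (le_trans (nrmD _ _))//.
  by rewrite lerD2r nrmZr ger0_norm// mulrC.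
- by move=> t _; rewrite -EFinM lee_fin mulr_ge0 ?nrm_ge0.
Qed.

(** The triangle inequality for step functions. The sets of a step function may
    overlap, so it is proved by cutting the domain along one set after the
    other; the constant c collects the values of the sets already treated. *)
Lemma nrm_step_int D s c : measurable D -> (mu D < +oo)%E -> step_valid mu s ->
  ((nrm ((fine (mu D))%:C *: c + step_int mu D s))%:E <=
   \int[mu]_(t in D) (nrm (c + step_fun s t))%:E)%E.
Proof.
elim: s D c => [|p s IH] D c mD fD.
  move=> _; rewrite /step_int big_nil addr0.
  under eq_integral do rewrite /step_fun big_nil addr0.
  rewrite integral_cst// nrmZr ger0_norm ?fine_ge0// -[in leRHS](fineK (x := mu D)).
    by rewrite -EFinM mulrC.
  by rewrite ge0_fin_numE.
move=> ps; have [mp _ vs] := step_valid_cons ps.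
have mD1 : measurable (D `&` p.1) by exact: measurableI.
have mD2 : measurable (D `\` p.1) by exact: measurableD.
have fD1 : (mu (D `&` p.1) < +oo)%E.
  by apply: le_lt_trans fD; apply: le_measure; rewrite ?inE//; exact: subIsetl.
have fD2 : (mu (D `\` p.1) < +oo)%E.
  by apply: le_lt_trans fD; apply: le_measure; rewrite ?inE//; exact: subDsetl.
have -> : (fine (mu D))%:C *: c + step_int mu D (p :: s) =
    ((fine (mu (D `&` p.1)))%:C *: (c + p.2) + step_int mu (D `&` p.1) s) +
    ((fine (mu (D `\` p.1)))%:C *: c + step_int mu (D `\` p.1) s).
  rewrite step_int_cons (step_int_split mD fD mp vs) scalerDr.
  have -> : mu D = (mu (D `&` p.1) + mu (D `\` p.1))%E.
    rewrite -measureU//; first by rewrite setUIDK.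
    by rewrite -subset0 => x [[_ Ex] [_ /(_ Ex)]].
  rewrite fineD ?ge0_fin_numE// rmorphD scalerDl [p.1 `&` D]setIC.
  move: (_ *: c) (_ *: c) (_ *: p.2) (step_int _ _ _) (step_int _ _ _) => a b e f g.
  by rewrite -!addrA [a + (e + _)]addrCA [a + (g + _)]addrCA.
have mE : measurable_fun D (fun t => (nrm (c + step_fun (p :: s) t))%:E).
  by apply/measurable_EFinP; exact: nrm_measurable_const_step.
rewrite -[X in (\int[mu]_(t in X) _)%E](setUIDK D p.1) ge0_integral_setU//; last 3 first.
- by rewrite setUIDK.
- by move=> t _; rewrite lee_fin nrm_ge0.
- by apply/disj_setPS => x [[_ Ex] [_ /(_ Ex)]].
apply: (@le_trans _ _ (_%:E + _%:E)%E); first by rewrite -EFinD lee_fin; exact: nrmD.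
apply: leeD.
  apply: le_trans (IH _ _ mD1 fD1 vs) _; rewrite le_eqVlt; apply/orP; left; apply/eqP.
  apply: eq_integral => t /[!inE] -[_ pt]; rewrite step_fun_cons indicE mem_set//.
  by rewrite scale1r addrA.
apply: le_trans (IH _ _ mD2 fD2 vs) _; rewrite le_eqVlt; apply/orP; left; apply/eqP.
apply: eq_integral => t /[!inE] -[_ pt]; rewrite step_fun_cons indicE memNset//.
by rewrite scale0r add0r.
Qed.

Lemma nrm_step_intB D s s' : measurable D -> (mu D < +oo)%E ->
  step_valid mu s -> step_valid mu s' ->
  ((nrm (step_int mu D s - step_int mu D s'))%:E <=
   \int[mu]_(t in D) (nrm (step_fun s t - step_fun s' t))%:E)%E.
Proof.
move=> mD fD vs vs'.
have vss := step_valid_cat vs (step_valid_opp vs').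
have := nrm_step_int 0 mD fD vss; rewrite scaler0 add0r.
have -> : step_int mu D (s ++ step_opp s') = step_int mu D s - step_int mu D s'.
  rewrite /step_int big_cat big_map /= -sumrN; congr (_ + _).
  by apply: eq_bigr => p _; rewrite scalerN.
under eq_integral => t _.
  have -> : 0 + step_fun (s ++ step_opp s') t = step_fun s t - step_fun s' t.
    by rewrite add0r step_fun_cat step_fun_opp.
  over.
by [].
Qed.

(** The step integrals of the two approximating sequences differ by at most the L1
    distance of the step functions, and this distance tends to that of f and h. Taking
    f = h gives uniqueness. *)
Lemma has_bochner_dist D f h v w : measurable D -> (mu D < +oo)%E ->
  nrm_measurable D f -> nrm_measurable D h ->
  measurable_fun D (fun t => nrm (f t - h t)) ->
  has_bochner mu D f v -> has_bochner mu D h w ->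
  ((nrm (v - w))%:E <= \int[mu]_(t in D) (nrm (f t - h t))%:E)%E.
Proof.
move=> mD fD mf mh mfh [s [vs _ sf sv]] [s' [vs' _ sh sw]].
set I := (\int[mu]_(t in D) (nrm (f t - h t))%:E)%E.
have I0 : (0 <= I)%E by apply: integral_ge0 => t _; rewrite lee_fin nrm_ge0.
have [->|Ioo] := eqVneq I +oo%E; first exact: leey.
have Ifin : I \is a fin_num by rewrite ge0_fin_numE// ltey.
pose a n := (\int[mu]_(t in D) (nrm (f t - step_fun (s n) t))%:E)%E.
pose b n := (\int[mu]_(t in D) (nrm (h t - step_fun (s' n) t))%:E)%E.
have le_n n : ((nrm (step_int mu D (s n) - step_int mu D (s' n)))%:E <= a n + b n + I)%E.
  apply: le_trans (nrm_step_intB mD fD (vs n) (vs' n)) _.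
  have m1 := nrm_measurable_stepB mD (vs n) mf.
  have m2 := nrm_measurable_stepB mD (vs' n) mh.
  rewrite /a /b /I -!ge0_integralD//=.
  - apply: ge0_le_integral => //.
    + by move=> t _; rewrite lee_fin nrm_ge0.
    + by apply/measurable_EFinP; exact: nrm_measurable_stepBB.
    + apply/measurable_EFinP; apply: measurable_funD => //.
      exact: measurable_funD.
    + move=> t _; rewrite -!EFinD lee_fin.
      have -> : step_fun (s n) t - step_fun (s' n) t = (f t - h t)
         - (f t - step_fun (s n) t) + (h t - step_fun (s' n) t).
        by rewrite opprB [f t - h t + _]addrC !addrA !subrK.
      rewrite (le_trans (nrmD _ _))// [leRHS]addrAC lerD2r.
      by rewrite (le_trans (nrmB _ _))// addrC.
  all: try by move=> t _; rewrite ?lee_fin ?addr_ge0 ?nrm_ge0.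
  all: try by apply/measurable_EFinP.
  by apply: emeasurable_funD; exact/measurable_EFinP.
have cl : (nrm (step_int mu D (s n) - step_int mu D (s' n)))%:E @[n --> \oo]
    --> (nrm (v - w))%:E.
  by apply: cvg_EFin; [exact: nearW|apply: cvg_nrm; exact: cvgB].
have cr : (a n + b n + I)%E @[n --> \oo] --> I.
  rewrite -[X in _ --> X]add0e -[X in (X + _)%E](adde0 0%E); apply: cvgeD => //.
    by apply: cvgeD.
  exact: cvg_cst.
have := lee_lim (cvgP _ cl) (cvgP _ cr).
rewrite (cvg_lim (@ereal_hausdorff R) cl) (cvg_lim (@ereal_hausdorff R) cr).
by apply; exact: nearW.
Qed.

Lemma has_bochner_unique D f v w : measurable D -> (mu D < +oo)%E ->
  nrm_measurable D f -> has_bochner mu D f v -> has_bochner mu D f w -> v = w.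
Proof.
move=> mD fD mf fv fw; apply/eqP; rewrite -subr_eq0; apply/eqP; apply: nrm0_eq0.
apply/eqP; rewrite eq_le nrm_ge0 andbT -lee_fin.
apply: le_trans (has_bochner_dist mD fD mf mf _ fv fw) _.
  by under eq_fun do rewrite subrr; exact: measurable_cst.
by under eq_integral do rewrite subrr nrm0; rewrite integral0.
Qed.

Lemma bochnerE D f v : measurable D -> (mu D < +oo)%E ->
  nrm_measurable D f -> has_bochner mu D f v -> bochner mu D f = v.
Proof.
move=> mD fD mf fv; apply: (has_bochner_unique mD fD mf _ fv).
by apply: xgetPex; exists v.
Qed.

End step_functions.

(** * Riemann sums *)

Lemma powR_comparable (R : realType) (x y r : R) : 0 < x -> 0 < y ->
  x <= 2 * y -> y <= 2 * x -> x `^ r <= 2 `^ `|r| * y `^ r.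
Proof.
move=> x0 y0 xy yx; have [r0|r0] := leP 0 r.
  by rewrite ger0_norm// -powRM// ?(ltW y0)// ge0_ler_powR// ?nnegrE ?mulr_ge0 ?(ltW x0) ?(ltW y0).
rewrite ltr0_norm// -[in leLHS](opprK r) -[in X in _ * X](opprK r).
move: (- r) (oppr_gt0 r) => p; rewrite r0 => p0.
rewrite !(powRN _ p) -ler_pdivrMr ?invr_gt0 ?powR_gt0// invrK mulrC.
rewrite ler_pdivrMr ?powR_gt0// -powRM// ?(ltW x0)//.
by rewrite ge0_ler_powR// ?nnegrE ?mulr_ge0 ?(ltW x0) ?(ltW y0) ?(ltW p0).
Qed.

Section riemann.
Context (R : realType) (X : completeNormedModType R[i]).
Local Notation leb := (@lebesgue_measure R).
Implicit Types (f h : R -> X) (s t : R) (n : nat).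

(** The n-th step function samples f on the grid of mesh t / (n + 3), leaving out
    the first and the last cell. Since every sample point s' of a cell containing
    s then satisfies s' <= s <= 2 s' and t - s <= t - s' <= 2 (t - s), a power
    singularity of f at 0 or at t bounds the step function as well. *)
Definition riemann_step t f n : seq (set R * X) :=
  [seq (`[t / n.+3%:R * k%:R, t / n.+3%:R * k.+1%:R[%classic, f (t / n.+3%:R * k%:R))
  | k <- iota 1 n.+1].

Definition riemann_sum t f n : X :=
  \sum_(k <- iota 1 n.+1) (t / n.+3%:R)%:C *: f (t / n.+3%:R * k%:R).

Lemma riemann_step_valid t f n : step_valid leb (riemann_step t f n).
Proof.
move=> p /mapP[k _ ->] /=; split; first exact: measurable_itv.
by rewrite lebesgue_measure_itv /=; case: ifP => _; rewrite -?EFinB ltry.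
Qed.

Let mesh_gt0 t n : 0 < t -> 0 < t / n.+3%:R.
Proof. by move=> t0; rewrite divr_gt0. Qed.

Let mesh_last t n : t / n.+3%:R * n.+2%:R = t - t / n.+3%:R.
Proof.
have {2}-> : t = t / n.+3%:R * n.+2%:R + t / n.+3%:R.
  by rewrite -[X in _ = _ + X]mulr1 -mulrDr natr1 divfK.
by rewrite addrK.
Qed.

Lemma riemann_cell t n k : 0 < t -> k \in iota 1 n.+1 ->
  fine (leb (`[t / n.+3%:R * k%:R, t / n.+3%:R * k.+1%:R[%classic `&` `]0%R, t[%classic)) =
  t / n.+3%:R.
Proof.
move=> t0; rewrite mem_iota => /andP[k1 kn].
have h0 := mesh_gt0 n t0; set h := t / _ in h0 *.
rewrite (_ : _ `&` _ = `[h * k%:R, h * k.+1%:R[%classic).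
  rewrite lebesgue_measure_itv /= lte_fin ltr_pM2l// ltr_nat ltnSn /=.
  by rewrite -mulrBr -natr1 addrAC subrr add0r mulr1.
apply/seteqP; split => x /=; rewrite !in_itv /=; first by case.
move=> /andP[kx xk]; split; first exact/andP.
rewrite (lt_le_trans _ kx) ?mulr_gt0 ?ltr0n//= (lt_le_trans xk)//.
rewrite (@le_trans _ _ (h * n.+2%:R))// ?ler_pM2l ?ler_nat//.
by rewrite mesh_last gerBl ltW.
Qed.

Lemma riemann_step_int t f n : 0 < t ->
  step_int leb `]0, t[%classic (riemann_step t f n) = riemann_sum t f n.
Proof.
move=> t0; rewrite /step_int big_map; apply: eq_big_seq => k kn /=.
by rewrite riemann_cell.
Qed.

Lemma riemann_stepE t f n s : 0 < t -> 0 < s -> let h := t / n.+3%:R in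
  step_fun (riemann_step t f n) s =
  if h <= s < t - h then f (h * (Num.truncn (s / h))%:R) else 0.
Proof.
move=> t0 s0 h; have h0 : 0 < h := mesh_gt0 n t0.
have sh : 0 <= s / h by rewrite divr_ge0 ?ltW.
rewrite /step_fun big_map /= -/h.
have indE k : (\1_(`[h * k%:R, h * k.+1%:R[%classic) s : R) =
    (Num.truncn (s / h) == k)%:R.
  rewrite indicE mem_setE in_itv /= truncn_eq//.
  by rewrite ler_pdivlMr// ltr_pdivrMr// ![_ * h]mulrC.
under eq_bigr do rewrite indE.
have -> : (h <= s < t - h) = (Num.truncn (s / h) \in iota 1 n.+1).
  rewrite mem_iota truncn_ge_nat// truncn_lt_nat// ler_pdivlMr// mul1r.
  by rewrite ltr_pdivrMr// mulrC mesh_last.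
case: ifPn => k0.
  rewrite (bigD1_seq _ k0 (iota_uniq _ _)) /= eqxx scale1r big1 ?addr0// => k.
  by rewrite eq_sym => /negPf ->; rewrite scale0r.
rewrite big_seq big1// => k kn; case: eqP => [kE|_]; last by rewrite scale0r.
by rewrite kE kn in k0.
Qed.

Lemma riemann_tagP t n s : 0 < t -> let h := t / n.+3%:R in
  let s' := h * (Num.truncn (s / h))%:R in
  h <= s < t - h -> [/\ h <= s', s' <= s, s < s' + h & s' + 2 * h <= t].
Proof.
move=> t0 h s' /andP[hs st]; have h0 : 0 < h := mesh_gt0 n t0.
have s0 : 0 < s := lt_le_trans h0 hs.
have sh : 0 <= s / h by rewrite divr_ge0 ?ltW.
have /andP[] := truncn_itv sh.
rewrite ler_pdivlMr// ltr_pdivrMr// ![_ * h]mulrC => h1 h2.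
split => //.
- rewrite -[leLHS]mulr1 ler_pM2l// (ler_nat _ 1) truncn_ge_nat//.
  by rewrite ler_pdivlMr// mul1r.
- by rewrite (lt_le_trans h2)// -natr1 mulrDr mulr1.
- have : (Num.truncn (s / h) < n.+2)%N.
    by rewrite truncn_lt_nat// ltr_pdivrMr// mulrC mesh_last.
  rewrite ltnS -(ler_nat R) -(ler_pM2l h0) -/s' => s'n.
  have := mesh_last t n; rewrite -/h -natr1 mulrDr mulr1.
  by move: s'n; lra.
Qed.


Lemma riemann_step_cvg t f s : 0 < s < t -> {for s, continuous f} ->
  step_fun (riemann_step t f n) s @[n --> \oo] --> f s.
Proof.
move=> /andP[s0 st] cf; have t0 : 0 < t := lt_trans s0 st.
have ts0 : 0 < t - s by rewrite subr_gt0.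
apply/nrm_cvgP/cvgrPdist_lt => e e0.
have := cf; move/nrm_cvgP/cvgrPdist_lt => /(_ e e0) /nbhs_ballP[d /= d0 fd].
pose m := Num.min d (Num.min s (t - s)).
have m0 : 0 < m by rewrite !lt_min d0 s0.
have := @cvg_harmonic R; move=> /cvgrPdist_lt /(_ (m / t)); rewrite divr_gt0// => /(_ isT).
apply: filterS => n; rewrite sub0r normrN ger0_norm; last by rewrite /harmonic invr_ge0.
rewrite /harmonic ltr_pdivlMr// => hn.
have hm : t / n.+3%:R < m.
  apply: le_lt_trans hn; rewrite mulrC ler_pM2r// lef_pV2 ?posrE// ler_nat.
  by rewrite !ltnS (leq_trans (leqnSn _)).
move: hm; rewrite !lt_min => /and3P[hd hs ht].
have hst : t / n.+3%:R <= s < t - t / n.+3%:R by rewrite (ltW hs) ltrBrDr -ltrBrDl.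
rewrite riemann_stepE// hst.
have [h1 h2 h3 h4] := riemann_tagP t0 hst.
apply: fd => /=; rewrite /ball /= ger0_norm ?subr_ge0//.
by apply: lt_trans hd; rewrite ltrBlDl.
Qed.

Lemma riemann_step_bound t f n (C p q : R) s : 0 <= C ->
  (forall s, 0 < s < t -> nrm (f s) <= C * (s `^ (q - 1) * (t - s) `^ (p - 1))) ->
  0 < s < t ->
  nrm (step_fun (riemann_step t f n) s) <=
    (2 `^ `|q - 1| * 2 `^ `|p - 1| * C) * (s `^ (q - 1) * (t - s) `^ (p - 1)).
Proof.
move=> C0 fC /andP[s0 st]; have t0 : 0 < t := lt_trans s0 st.
have ts0 : 0 < t - s by rewrite subr_gt0.
rewrite riemann_stepE//; case: ifPn => [hst|_]; last first.
  by rewrite nrm0 !mulr_ge0 ?powR_ge0.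
have [h1 h2 h3 h4] := riemann_tagP t0 hst.
have h0 : 0 < t / n.+3%:R by rewrite divr_gt0.
move: (t / n.+3%:R) (t / n.+3%:R * _) h0 hst h1 h2 h3 h4 => h s' h0 /andP[hs hst] h1 h2 h3 h4.
have s'0 : 0 < s' := lt_le_trans h0 h1.
have ts' : 0 < t - s' by move: h4 h0; lra.
have s't : 0 < s' < t by rewrite s'0 /=; move: ts'; lra.
apply: (le_trans (fC _ s't)).
rewrite (_ : _ * C * _ = C * ((2 `^ `|q - 1| * s `^ (q - 1)) *
  (2 `^ `|p - 1| * (t - s) `^ (p - 1)))); last by ring.
apply: ler_wpM2l => //; apply: ler_pM; rewrite ?powR_ge0//.
  by apply: powR_comparable => //; move: h1 h2 h3 h4 h0; lra.
by apply: powR_comparable => //; move: h1 h2 h3 h4 h0; lra.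
Qed.

Lemma nrm_measurable_continuous t f : (forall s, 0 < s < t -> {for s, continuous f}) ->
  nrm_measurable `]0, t[%classic f.
Proof.
move=> cf c; apply: open_continuous_measurable_fun; first exact: itv_open.
move=> s; rewrite inE /= in_itv /= => /cf cfs.
by apply: cvg_nrm; apply: cvgD; [exact: cfs|exact: cvg_cst].
Qed.

(** The functions whose Bochner integral over ]0, t[ is computed by Riemann sums:
    the majorant allows integrable power singularities at both ends. *)
Definition beta_dominated t f := (forall s, 0 < s < t -> {for s, continuous f}) /\
  exists C p q : R, [/\ 0 < p, 0 < q, 0 <= C & forall s, 0 < s < t ->
    nrm (f s) <= C * (s `^ (q - 1) * (t - s) `^ (p - 1))].

Lemma lebesgue_itv0_lty t : (leb `]0%R, t[%classic < +oo)%E.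
Proof. by rewrite lebesgue_measure_itv /=; case: ifP => _; rewrite -?EFinB ltry. Qed.

Lemma integrable_beta t (C p q : R) : 0 < t -> 0 < p -> 0 < q -> 0 <= C ->
  leb.-integrable `]0, t[%classic
    (fun s => (C * (s `^ (q - 1) * (t - s) `^ (p - 1)))%:E).
Proof.
move=> t0 p0 q0 C0.
have mf : measurable_fun `]0, t[%classic (fun s : R => s `^ (q - 1) * (t - s) `^ (p - 1)).
  apply: measurable_funM.
    by apply: measurable_funTS; exact: measurable_powR.
  apply: measurable_funTS; apply: (@measurableT_comp _ _ _ _ _ _ (fun x => x `^ (p - 1))).
    exact: measurable_powR.
  exact: measurable_funB.
apply/integrableP; split; first by apply/measurable_EFinP; exact: measurable_funM.
under eq_integral => s _ do rewrite abse_EFin ger0_norm ?mulr_ge0 ?powR_ge0// EFinM.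
rewrite ge0_integralZl_EFin//; last 2 first.
- by move=> s _; rewrite lee_fin mulr_ge0 ?powR_ge0.
- by apply/measurable_EFinP.
rewrite integral_convolution//.
suff -> : beta_integral q p = (Gamma q * Gamma p / Gamma (q + p))%:E by rewrite -!EFinM ltry.
have Gqp : Gamma (q + p) != 0 by rewrite gt_eqF// Gamma_gt0// addr_gt0.
have -> : beta_integral q p = ((Gamma (q + p))^-1%:E * ((Gamma (q + p))%:E * beta_integral q p))%E.
  by rewrite muleA -EFinM mulVf// mul1e.
rewrite -GammaE ?addr_gt0// -gamma_beta !GammaE// -!EFinM; congr EFin.
by rewrite mulrC.
Qed.

(** Dominated convergence: the step functions obey the majorant of f up to a factor. *)
Lemma riemann_step_L1 t f : 0 < t -> beta_dominated t f ->
  (\int[leb]_(s in `]0%R, t[) (nrm (f s - step_fun (riemann_step t f n) s))%:E)%E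
    @[n --> \oo] --> 0%E.
Proof.
move=> t0 [cf [C [p [q [p0 q0 C0 fC]]]]].
pose K := C + 2 `^ `|q - 1| * 2 `^ `|p - 1| * C.
have K0 : 0 <= K by rewrite addr_ge0// !mulr_ge0 ?powR_ge0.
have := @dominated_cvg _ _ R leb `]0, t[%classic (measurable_itv _)
  (fun n s => (nrm (f s - step_fun (riemann_step t f n) s))%:E) (cst 0%E)
  (fun s => (K * (s `^ (q - 1) * (t - s) `^ (p - 1)))%:E).
rewrite integral0; apply.
- move=> n; apply/measurable_EFinP.
  apply: (nrm_measurable_stepB (mu := leb)).
  + exact: measurable_itv.
  + exact: riemann_step_valid.
  + exact: nrm_measurable_continuous.
- move=> s; rewrite /= in_itv /= => s0t; apply: cvg_EFin; first exact: nearW.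
  rewrite -[X in _ --> X](@nrm0 R X) -(subrr (f s)).
  apply: cvg_nrm; apply: cvgB; first exact: cvg_cst.
  by apply: riemann_step_cvg => //; exact: cf.
- by [].
- exact: integrable_beta.
- move=> n s; rewrite /= in_itv /= => s0t; rewrite lee_fin ger0_norm ?nrm_ge0//.
  rewrite (le_trans (nrmB _ _))// /K mulrDl lerD ?fC//.
  exact: riemann_step_bound.
Qed.

(** The Riemann sums form a Cauchy sequence because the step functions do in L1. *)
Lemma riemann_has_bochner t f : 0 < t -> beta_dominated t f ->
  exists2 v, has_bochner leb `]0, t[%classic f v &
    riemann_sum t f n @[n --> \oo] --> v.
Proof.
move=> t0 bf; have L1 := riemann_step_L1 t0 bf; have [cf _] := bf.
have mD : measurable `]0, t[%classic by exact: measurable_itv.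
suff /cvg_ex[v cv] : cvgn (riemann_sum t f).
  exists v => //; exists (riemann_step t f); split => //.
  - by move=> n; exact: riemann_step_valid.
  - by apply: aeW => s; rewrite /= in_itv /= => s0t; apply: riemann_step_cvg => //; exact: cf.
  - by under eq_fun do rewrite riemann_step_int//.
apply: nrm_cauchy_cvg => e e0.
have e2 : (0%:E < (e / 2)%:E :> \bar R)%E by rewrite lte_fin divr_gt0.
have mf := nrm_measurable_continuous cf.
have mfs n : measurable_fun `]0, t[%classic
    (fun s => nrm (f s - step_fun (riemann_step t f n) s)).
  apply: (nrm_measurable_stepB (mu := leb)) => //; exact: riemann_step_valid.
have [N _ HN] : \forall n \near \oo, (\int[leb]_(s in `]0%R, t[)
    (nrm (f s - step_fun (riemann_step t f n) s))%:E < (e / 2)%:E)%E.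
  move: L1 => /fine_cvgP[fin] /cvgrPdist_lt /(_ (e / 2)); rewrite lte_fin in e2.
  move=> /(_ e2); apply: filterS2 fin => n fn; rewrite sub0r normrN => hn.
  by rewrite -(fineK fn) lte_fin; apply: le_lt_trans hn; rewrite ler_norm.
exists N => m n Nm Nn; rewrite -lee_fin -!riemann_step_int//.
apply: le_trans.
  apply: (nrm_step_intB (mu := leb)) => //; first exact: lebesgue_itv0_lty.
    exact: riemann_step_valid.
  exact: riemann_step_valid.
rewrite (splitr e) EFinD; apply: le_trans (leeD (ltW (HN m Nm)) (ltW (HN n Nn))).
rewrite -ge0_integralD//.
- apply: ge0_le_integral => //.
  + by move=> s _; rewrite lee_fin nrm_ge0.
  + apply/measurable_EFinP; apply: (nrm_measurable_stepBB (mu := leb)) => //;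
      exact: riemann_step_valid.
  + by apply: emeasurable_funD; apply/measurable_EFinP; exact: mfs.
  + move=> s _; rewrite -EFinD lee_fin -(subrKA (f s)) (le_trans (nrmD _ _))//.
    by rewrite nrmBC.
- by move=> s _; rewrite lee_fin nrm_ge0.
- by apply/measurable_EFinP; exact: mfs.
- by move=> s _; rewrite lee_fin nrm_ge0.
- by apply/measurable_EFinP; exact: mfs.
Qed.

Lemma bochner_riemann t f : 0 < t -> beta_dominated t f ->
  riemann_sum t f n @[n --> \oo] --> bochner leb `]0, t[%classic f.
Proof.
move=> t0 bf; have [v fv] := riemann_has_bochner t0 bf.
rewrite (bochnerE _ _ _ fv)//.
- exact: lebesgue_itv0_lty.
- by apply: nrm_measurable_continuous; case: bf.
Qed.

Lemma bochner_dist t f h : 0 < t -> beta_dominated t f -> beta_dominated t h ->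
  ((nrm (bochner leb `]0, t[%classic f - bochner leb `]0, t[%classic h))%:E <=
   \int[leb]_(s in `]0%R, t[) (nrm (f s - h s))%:E)%E.
Proof.
move=> t0 bf bh; have [v fv _] := riemann_has_bochner t0 bf.
have [w hw _] := riemann_has_bochner t0 bh.
have mf : nrm_measurable `]0, t[%classic f by apply: nrm_measurable_continuous; case: bf.
have mh : nrm_measurable `]0, t[%classic h by apply: nrm_measurable_continuous; case: bh.
have mD : measurable `]0, t[%classic by exact: measurable_itv.
have fD := lebesgue_itv0_lty t.
rewrite (bochnerE (mu := leb) mD fD mf fv) (bochnerE (mu := leb) mD fD mh hw).
apply: (has_bochner_dist (mu := leb) mD fD mf mh) => //.
apply: open_continuous_measurable_fun; first exact: itv_open.
move=> s; rewrite inE /= in_itv /= => s0t; apply: cvg_nrm.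
by apply: cvgB; [case: bf => + _|case: bh => + _]; exact.
Qed.

End riemann.

Section real_scaling.
Context {R : realType} {V : normedModType R[i]}.

Lemma cvg_scale_real T (F : set_system T) {FF : Filter F} (a : T -> R) (f : T -> V) (a0 : R) (l : V) :
  a x @[x --> F] --> a0 -> f x @[x --> F] --> l ->
  (a x)%:C *: f x @[x --> F] --> a0%:C *: l.
Proof.
move=> aa fl; apply/nrm_cvgP.
apply: (@squeeze_cvgr _ _ _ _ (fun=> 0)
    (fun x => `|a x - a0| * nrm (f x) + `|a0| * nrm (f x - l))).
- apply: nearW => x; rewrite nrm_ge0 /=.
  have -> : (a x)%:C *: f x - a0%:C *: l =
      (a x - a0)%:C *: f x + a0%:C *: (f x - l).
    by rewrite rmorphB scalerBl scalerBr addrA subrK.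
  by rewrite (le_trans (nrmD _ _))// !nrmZr.
- exact: cvg_cst.
- have -> : 0 = `|a0 - a0| * nrm l + `|a0| * 0 by rewrite subrr normr0 mul0r mulr0 addr0.
  apply: cvgD; apply: cvgM.
  + by apply: cvg_norm; apply: cvgB => //; exact: cvg_cst.
  + exact: cvg_nrm.
  + exact: cvg_cst.
  + exact/nrm_cvgP.
Qed.

Lemma cvg_scale (T : Type) (F : set_system T) {FF : Filter F} (a : R[i]) (f : T -> V) (l : V) :
  f x @[x --> F] --> l -> a *: f x @[x --> F] --> a *: l.
Proof.
move=> /nrm_cvgP fl; apply/nrm_cvgP; under eq_fun do rewrite -scalerBr nrmZ.
by rewrite -(mulr0 (complex.Re `|a|)); apply: cvgMl_tmp.
Qed.

End real_scaling.

Section riemann_sums.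
Context (R : realType) (X : completeNormedModType R[i]).
Local Notation leb := (@lebesgue_measure R).
Implicit Types (f h : R -> X) (s t : R) (n : nat).

Lemma riemann_tag_itv t n k : 0 < t -> k \in iota 1 n.+1 ->
  0 < t / n.+3%:R * k%:R < t.
Proof.
move=> t0; rewrite mem_iota => /andP[k1 kn].
rewrite mulr_gt0 ?divr_gt0 ?ltr0n//= mulrAC ltr_pdivrMr// ltr_pM2l// ltr_nat.
by rewrite (leq_trans kn)// ltnW.
Qed.

Lemma eq_riemann_sum t f h n : 0 < t -> (forall s, 0 < s < t -> f s = h s) ->
  riemann_sum t f n = riemann_sum t h n.
Proof.
move=> t0 fh; apply: eq_big_seq => k kn; rewrite fh//; exact: riemann_tag_itv.
Qed.

Lemma riemann_sum_linear t f h (a : R[i]) n :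
  riemann_sum t (fun s => a *: f s + h s) n = a *: riemann_sum t f n + riemann_sum t h n.
Proof.
rewrite /riemann_sum scaler_sumr -big_split; apply: eq_bigr => k _ /=.
by rewrite scalerDr !scalerA mulrC.
Qed.

Lemma riemann_sum_scale t f n :
  riemann_sum t f n = riemann_sum 1 (fun s => t%:C *: f (t * s)) n.
Proof.
apply: eq_bigr => k _; rewrite scalerA -rmorphM /= mul1r mulrA.
by rewrite [_^-1 * t]mulrC.
Qed.

Lemma bochner_eq t t' f h : 0 < t -> 0 < t' ->
  beta_dominated t f -> beta_dominated t' h ->
  (forall n, riemann_sum t f n = riemann_sum t' h n) ->
  bochner leb `]0, t[%classic f = bochner leb `]0, t'[%classic h.
Proof.
move=> t0 t'0 bf bh e; have := bochner_riemann t'0 bh.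
rewrite -(funext e) => /cvg_lim <-//.
by apply/esym/cvg_lim => //; exact: bochner_riemann.
Qed.

Lemma beta_dominated0 t : beta_dominated t (fun=> 0 : X).
Proof.
split=> [s _|]; first exact: cvg_cst.
by exists 0, 1, 1; split => // s _; rewrite nrm0 mul0r.
Qed.

Lemma bochner0 t : 0 < t -> bochner leb `]0, t[%classic (fun=> 0 : X) = 0.
Proof.
move=> t0; have := bochner_riemann t0 (beta_dominated0 t) => /cvg_lim <-//.
by rewrite (_ : riemann_sum t _ = fun=> 0) ?lim_cst//; apply/funext => n;
  rewrite /riemann_sum big1// => k _; rewrite scaler0.
Qed.

Lemma nrm_bochner t f : 0 < t -> beta_dominated t f ->
  ((nrm (bochner leb `]0, t[%classic f))%:E <=
   \int[leb]_(s in `]0%R, t[) (nrm (f s))%:E)%E.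
Proof.
move=> t0 bf; have := bochner_dist t0 bf (beta_dominated0 t).
by rewrite bochner0// subr0; under eq_integral do rewrite subr0.
Qed.

End riemann_sums.

(** * Fractional integration *)

Section fractional_integral.
Context (R : realType) (X : completeNormedModType R[i]).
Local Notation leb := (@lebesgue_measure R).
Implicit Types (f h : R -> X) (s t : R) (n : nat).

Definition frac_int a f t : X := bochner leb `]0, t[%classic (conv_integrand a f t).

(** The constant C does not change under fractional integration, only the exponent g
    does; this uniformity makes the Neumann series below converge. *)
Definition tame g T C f := 0 <= C /\ forall s, 0 < s < T ->
  {for s, continuous f} /\ nrm (f s) <= C * g_ g s.

Lemma powR_continuous (r s : R) : 0 < s -> {for s, continuous (fun x : R => x `^ r)}.
Proof.
move=> s0; apply: differentiable_continuous; apply/derivable1_diffP.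
by apply: derivable_powR; rewrite in_itv /= s0.
Qed.

Lemma g_continuous (a s : R) : 0 < s -> {for s, continuous (g_ a)}.
Proof.
by move=> s0; apply: cvgM; [exact: powR_continuous|exact: cvg_cst].
Qed.

Lemma conv_continuous a f t s : s < t -> {for s, continuous f} ->
  {for s, continuous (conv_integrand a f t)}.
Proof.
move=> st cf; apply: cvg_scale_real => //.
apply: (@continuous_cvg _ _ _ _ _ (fun x : R => t - x) (g_ a) (t - s)).
  by apply: g_continuous; rewrite subr_gt0.
by apply: cvgB; [exact: cvg_cst|exact: cvg_id].
Qed.

Lemma conv_bound a g T C f t s : 0 < a -> 0 < g -> tame g T C f -> 0 < s < t -> t < T ->
  nrm (conv_integrand a f t s) <=
  C / (Gamma a * Gamma g) * (s `^ (g - 1) * (t - s) `^ (a - 1)).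
Proof.
move=> a0 g0 [C0 fT] /andP[s0 st] tT.
have [_ fs] : {for s, continuous f} /\ nrm (f s) <= C * g_ g s.
  by apply: fT; rewrite s0 (lt_trans st).
have ts0 : 0 < t - s by rewrite subr_gt0.
rewrite /conv_integrand nrmZr ger0_norm; last exact: ltW (g_gt0 a0 ts0).
apply: (le_trans (ler_wpM2l (ltW (g_gt0 a0 ts0)) fs)).
rewrite le_eqVlt; apply/orP; left; apply/eqP; rewrite /g_.
by field; rewrite !gt_eqF// Gamma_gt0.
Qed.

Lemma conv_beta_dominated a g T C f t : 0 < a -> 0 < g -> tame g T C f -> 0 < t < T ->
  beta_dominated t (conv_integrand a f t).
Proof.
move=> a0 g0 fT /andP[t0 tT]; have [C0 fc] := fT; split.
  move=> s /andP[s0 st]; apply: conv_continuous => //.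
  by have [] := fc s; rewrite // s0 (lt_trans st).
exists (C / (Gamma a * Gamma g)), a, g; split => //.
  by rewrite divr_ge0// mulr_ge0// ltW// Gamma_gt0.
by move=> s s0t; apply: (conv_bound a0 g0 fT).
Qed.

Lemma frac_int_riemann a g T C f t : 0 < a -> 0 < g -> tame g T C f -> 0 < t < T ->
  riemann_sum t (conv_integrand a f t) n @[n --> \oo] --> frac_int a f t.
Proof.
move=> a0 g0 fT t0T; apply: bochner_riemann; first by case/andP: t0T.
exact: conv_beta_dominated fT _.
Qed.

Lemma frac_int_linear a g T C C' C'' f h k (c : R[i]) t : 0 < a -> 0 < g ->
  tame g T C f -> tame g T C' h -> tame g T C'' k -> 0 < t < T ->
  (forall s, 0 < s < t -> k s = c *: f s + h s) ->
  frac_int a k t = c *: frac_int a f t + frac_int a h t.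
Proof.
move=> a0 g0 fT hT kT t0T kE; have /andP[t0 tT] := t0T.
have := frac_int_riemann a0 g0 kT t0T => /cvg_lim <-//.
apply/cvg_lim => //.
have e n : riemann_sum t (conv_integrand a k t) n =
    c *: riemann_sum t (conv_integrand a f t) n + riemann_sum t (conv_integrand a h t) n.
  rewrite -riemann_sum_linear; apply: eq_riemann_sum => // s s0t.
  by rewrite /conv_integrand kE// scalerDr !scalerA mulrC.
rewrite (funext e); apply: cvgD; last exact: frac_int_riemann hT _.
by apply: cvg_scale; exact: frac_int_riemann fT _.
Qed.

(** Fractional integration commutes with a closed operator: apply the operator to
    the Riemann sums. *)
Lemma frac_int_closed (A : linop X) a g g' T C C' f h t : closed_op A ->
  0 < a -> 0 < g -> 0 < g' ->
  tame g T C f -> tame g' T C' h -> 0 < t < T ->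
  (forall s, 0 < s < t -> dom A (f s) /\ A (f s) = h s) ->
  dom A (frac_int a f t) /\ A (frac_int a f t) = frac_int a h t.
Proof.
move=> cA a0 g0 g'0 fT hT t0T fh; have /andP[t0 tT] := t0T.
have e n : dom A (riemann_sum t (conv_integrand a f t) n) /\
    A (riemann_sum t (conv_integrand a f t) n) = riemann_sum t (conv_integrand a h t) n.
  have tagd k : k \in iota 1 n.+1 ->
    dom A ((t / n.+3%:R)%:C *: conv_integrand a f t (t / n.+3%:R * k%:R)).
    by move=> kn; do 2 apply: domZ; have [] := fh _ (riemann_tag_itv t0 kn).
  have [d ->] := linop_sum tagd; split => //.
  apply: eq_big_seq => k kn; have [df Af] := fh _ (riemann_tag_itv t0 kn).
  by rewrite !linopZ ?Af//; exact: domZ.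
apply: (closed_opP cA (u := riemann_sum t (conv_integrand a f t))).
- by move=> n; have [] := e n.
- exact: frac_int_riemann fT _.
- under eq_fun do rewrite (e _).2.
  exact: frac_int_riemann hT _.
Qed.

Lemma measurable_convolution (a g t : R) :
  measurable_fun `]0, t[%classic (fun s : R => g_ a (t - s) * g_ g s).
Proof.
apply: open_continuous_measurable_fun; first exact: itv_open.
move=> s; rewrite inE /= in_itv /= => /andP[s0 st].
apply: cvgM; last exact: g_continuous.
apply: (@continuous_cvg _ _ _ _ _ (fun x : R => t - x) (g_ a) (t - s)).
  by apply: g_continuous; rewrite subr_gt0.
by apply: cvgB; [exact: cvg_cst|exact: cvg_id].
Qed.

Lemma frac_int_bound a g T C f t : 0 < a -> 0 < g -> tame g T C f -> 0 < t < T ->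
  nrm (frac_int a f t) <= C * g_ (a + g) t.
Proof.
move=> a0 g0 fT t0T; have /andP[t0 tT] := t0T; have [C0 fc] := fT.
have mgg := @measurable_convolution a g t.
rewrite -lee_fin; apply: le_trans.
  exact: nrm_bochner (conv_beta_dominated a0 g0 fT t0T).
rewrite EFinM -(g_convolution a0 g0 t0).
rewrite -ge0_integralZl_EFin//; last 2 first.
- move=> s /=; rewrite in_itv /= => /andP[s0 st].
  by rewrite lee_fin; apply: mulr_ge0; apply/ltW/g_gt0; rewrite ?subr_gt0.
- by apply/measurable_EFinP.
have pw s : `]0, t[%classic s ->
    (nrm (conv_integrand a f t s) <= C * (g_ a (t - s) * g_ g s)).
  rewrite /= in_itv /= => /andP[s0 st].
  rewrite /conv_integrand nrmZr ger0_norm; last by rewrite ltW// g_gt0// subr_gt0.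
  rewrite mulrCA ler_wpM2l//; first by rewrite ltW// g_gt0// subr_gt0.
  by apply: (fc s _).2; rewrite s0 (lt_trans st).
apply: ge0_le_integral => //.
- by move=> s _; rewrite lee_fin nrm_ge0.
- apply/measurable_EFinP; apply: open_continuous_measurable_fun; first exact: itv_open.
  move=> s; rewrite inE /= in_itv /= => s0t; apply: cvg_nrm.
  by case: (conv_beta_dominated a0 g0 fT t0T) => + _; exact.
- by apply/measurable_EFinP; apply: measurable_funM => //; exact: measurable_cst.
Qed.

Lemma kernel_tame g T (x : X) : 0 < g -> tame g T (nrm x) (fun s => (g_ g s)%:C *: x).
Proof.
move=> g0; split=> [|s /andP[s0 _]]; first exact: nrm_ge0.
split; first by apply: cvg_scale_real; [exact: g_continuous|exact: cvg_cst].
by rewrite nrmZr ger0_norm 1?mulrC//; exact: ltW (g_gt0 g0 s0).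
Qed.

(** The Riemann sums are nonnegative multiples kappa n of x, so it is enough to find the
    limit of kappa n, which is done by estimating the norm of the integral from both
    sides. *)
Lemma frac_int_kernel a g t (x : X) : 0 < a -> 0 < g -> 0 < t ->
  frac_int a (fun s => (g_ g s)%:C *: x) t = (g_ (a + g) t)%:C *: x.
Proof.
move=> a0 g0 t0; pose k s := (g_ g s)%:C *: x.
have kT : tame g (t + 1) (nrm x) k by exact: kernel_tame.
have t0T : 0 < t < t + 1 by rewrite t0 ltrDl ltr01.
have bk := conv_beta_dominated a0 g0 kT t0T.
have Sv := frac_int_riemann a0 g0 kT t0T; set v := frac_int a k t in Sv *.
have I0 : 0 < g_ (a + g) t by rewrite g_gt0// addr_gt0.
pose kappa n := \sum_(i <- iota 1 n.+1) t / n.+3%:R *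
  (g_ a (t - t / n.+3%:R * i%:R) * g_ g (t / n.+3%:R * i%:R)).
have SE n : riemann_sum t (conv_integrand a k t) n = (kappa n)%:C *: x.
  rewrite /riemann_sum /kappa rmorph_sum scaler_suml; apply: eq_bigr => i _.
  by rewrite /conv_integrand /k !scalerA -!rmorphM /= !mulrA.
have kappa0 n : 0 <= kappa n.
  rewrite /kappa big_seq; apply: sumr_ge0 => i /(riemann_tag_itv t0) /andP[i0 it].
  by apply: mulr_ge0; [rewrite divr_ge0 ?(ltW t0)|
    apply: mulr_ge0; apply/ltW/g_gt0; rewrite ?subr_gt0].
have nv : nrm v = g_ (a + g) t * nrm x.
  apply/eqP; rewrite eq_le mulrC; apply/andP; split.
    exact: frac_int_bound kT t0T.
  pose L n := (\int[leb]_(s in `]0%R, t[) (nrm (conv_integrand a k t s -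
    step_fun (riemann_step t (conv_integrand a k t) n) s))%:E)%E.
  pose S n := riemann_sum t (conv_integrand a k t) n.
  have mL n : measurable_fun `]0, t[%classic (fun s => nrm (conv_integrand a k t s -
      step_fun (riemann_step t (conv_integrand a k t) n) s)).
    apply: (nrm_measurable_stepB (mu := leb)); first exact: measurable_itv.
      exact: riemann_step_valid.
    by apply: nrm_measurable_continuous; case: bk.
  have le_n n : ((nrm x * g_ (a + g) t)%:E <= L n + (nrm (S n))%:E)%E.
    have -> : (nrm (S n))%:E = (\sum_(p <- riemann_step t (conv_integrand a k t) n)
        fine (leb (p.1 `&` `]0, t[%classic)) * nrm p.2)%:E.
      rewrite /S SE nrmZr ger0_norm// /kappa mulr_suml big_map; congr EFin.
      apply: eq_big_seq => i ni; have /andP[i0 it] := riemann_tag_itv t0 ni.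
      have ga : 0 < g_ a (t - t / n.+3%:R * i%:R) by rewrite g_gt0// subr_gt0.
      have gg := g_gt0 g0 i0.
      by rewrite /= riemann_cell// /conv_integrand /k !nrmZr !gtr0_norm// !mulrA.
    apply: le_trans (leeD (lexx _) _); last first.
      apply: (integral_nrm_step (mu := leb)); first exact: measurable_itv.
        exact: lebesgue_itv0_lty.
      exact: riemann_step_valid.
    have ms : measurable_fun `]0, t[%classic (fun s => nrm
        (step_fun (riemann_step t (conv_integrand a k t) n) s)).
      have mD : measurable (`]0, t[%classic : set (measurableTypeR R)).
        exact: measurable_itv.
      have vs := @riemann_step_valid R X t (conv_integrand a k t) n.
      have := nrm_measurable_const_step (mu := leb) 0 mD vs.
      by apply: eq_measurable_fun => s _; rewrite add0r.
    rewrite EFinM -(g_convolution a0 g0 t0) -ge0_integralZl_EFin ?nrm_ge0//; last 2 first.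
    - move=> s /=; rewrite in_itv /= => /andP[s0 st].
      by rewrite lee_fin; apply: mulr_ge0; apply/ltW/g_gt0; rewrite ?subr_gt0.
    - by apply/measurable_EFinP; exact: measurable_convolution.
    rewrite /L -ge0_integralD//; last 4 first.
    - by move=> s _; rewrite lee_fin nrm_ge0.
    - by apply/measurable_EFinP; exact: mL.
    - by move=> s _; rewrite lee_fin nrm_ge0.
    - by apply/measurable_EFinP; exact: ms.
    apply: ge0_le_integral => //.
    - move=> s /=; rewrite in_itv /= => /andP[s0 st].
      rewrite -EFinM lee_fin; apply: mulr_ge0; first exact: nrm_ge0.
      by apply: mulr_ge0; apply/ltW/g_gt0; rewrite ?subr_gt0.
    - apply: measurable_funeM; apply/measurable_EFinP; exact: measurable_convolution.
    - by apply: emeasurable_funD; apply/measurable_EFinP; [exact: mL|exact: ms].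
    - move=> s /=; rewrite in_itv /= => /andP[s0 st].
      rewrite -EFinM -EFinD lee_fin.
      have <- : nrm (conv_integrand a k t s) = nrm x * (g_ a (t - s) * g_ g s).
        have ga : 0 < g_ a (t - s) by rewrite g_gt0// subr_gt0.
        have gg := g_gt0 g0 s0.
        by rewrite /conv_integrand /k !nrmZr !gtr0_norm// mulrA mulrC.
      by rewrite -[X in nrm X <= _](subrK (step_fun (riemann_step t (conv_integrand a k t) n) s)) nrmD.
  have cL : (L n + (nrm (S n))%:E)%E @[n --> \oo] --> (nrm v)%:E.
    rewrite -[X in _ --> X]add0e; apply: cvgeD => //; first exact: riemann_step_L1.
    by apply: cvg_EFin; [exact: nearW|exact: cvg_nrm].
  have : ((nrm x * g_ (a + g) t)%:E <= lim ((L n + (nrm (S n))%:E)%E @[n --> \oo]))%E.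
    by apply: lime_ge; [exact: cvgP cL|exact: nearW].
  by rewrite (cvg_lim (@ereal_hausdorff R) cL).
have [/nrm0_eq0 x0|xn0] := eqVneq (nrm x) 0.
  by rewrite x0 scaler0; apply: nrm0_eq0; rewrite nv x0 nrm0 mulr0.
have kI : kappa n @[n --> \oo] --> g_ (a + g) t.
  have -> : kappa = fun n => nrm (riemann_sum t (conv_integrand a k t) n) / nrm x.
    by apply/funext => n; rewrite SE nrmZr ger0_norm// mulfK.
  by rewrite -(mulfK xn0 (g_ (a + g) t)) -nv; apply: cvgMr_tmp; exact: cvg_nrm.
rewrite -(cvg_lim (@norm_hausdorff _ _) Sv); apply/cvg_lim => //; rewrite (funext SE).
by apply: cvg_scale_real => //; exact: cvg_cst.
Qed.

(* the substitution s = t * r in the fractional integral *)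
Let rescaled a f t (r : R) : X := t%:C *: conv_integrand a f t (t * r).

Let rescaled_bound a g T C f t r : 0 < a -> 0 < g -> tame g T C f -> 0 < t < T ->
  0 < r < 1 -> nrm (rescaled a f t r) <=
  C / (Gamma a * Gamma g) * t `^ (a + g - 1) * (r `^ (g - 1) * (1 - r) `^ (a - 1)).
Proof.
move=> a0 g0 fT /andP[t0 tT] /andP[r0 r1].
have r10 : 0 < 1 - r by rewrite subr_gt0.
have tr : 0 < t * r < t by rewrite mulr_gt0//= gtr_pMr.
rewrite /rescaled nrmZr gtr0_norm//.
apply: (le_trans (ler_wpM2l (ltW t0) (conv_bound a0 g0 fT tr tT))).
rewrite (_ : t - t * r = t * (1 - r)); last by ring.
rewrite !powRM ?(ltW t0) ?(ltW r0) ?(ltW r10)//.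
have -> : t `^ (a + g - 1) = t * (t `^ (g - 1) * t `^ (a - 1)).
  rewrite -powRD ?(lt0r_neq0 t0) ?implybT// -[X in X * _](powRr1 (ltW t0)).
  rewrite -powRD ?(lt0r_neq0 t0) ?implybT//; congr (_ `^ _); ring.
by rewrite le_eqVlt; apply/orP; left; apply/eqP; ring.
Qed.

Let rescaled_continuous a g T C f t r : tame g T C f -> 0 < t < T -> 0 < r < 1 ->
  {for r, continuous (rescaled a f t)}.
Proof.
move=> [_ fT] /andP[t0 tT] /andP[r0 r1].
have trt : t * r < t by rewrite gtr_pMr.
apply: cvg_scale; apply: (@continuous_cvg _ _ _ _ _ (fun x : R => t * x)
  (conv_integrand a f t) (t * r)).
  apply: conv_continuous => //.
  by have [] := fT (t * r); rewrite // mulr_gt0//= (lt_trans trt).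
by apply: cvgM; [exact: cvg_cst|exact: cvg_id].
Qed.

Let rescaled_beta a g T C f t : 0 < a -> 0 < g -> tame g T C f -> 0 < t < T ->
  beta_dominated 1 (rescaled a f t).
Proof.
move=> a0 g0 fT t0T; have [C0 _] := fT; split.
  by move=> r r01; exact: rescaled_continuous fT t0T r01.
exists (C / (Gamma a * Gamma g) * t `^ (a + g - 1)), a, g; split => //.
  by rewrite mulr_ge0 ?powR_ge0// divr_ge0// mulr_ge0// ltW// Gamma_gt0.
by move=> r r01; exact: (rescaled_bound a0 g0 fT t0T r01).
Qed.

Let frac_int_rescaled a g T C f t : 0 < a -> 0 < g -> tame g T C f -> 0 < t < T ->
  frac_int a f t = bochner leb `]0, 1[%classic (rescaled a f t).
Proof.
move=> a0 g0 fT t0T; have /andP[t0 tT] := t0T; apply: bochner_eq => //.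
- exact: conv_beta_dominated fT t0T.
- exact: rescaled_beta fT t0T.
- by move=> n; exact: riemann_sum_scale.
Qed.

(** Rescaling the interval of integration to ]0, 1[ moves the parameter t into the
    integrand, where dominated convergence gives continuity. *)
Lemma frac_int_tame a g T C f : 0 < a -> 0 < g -> tame g T C f ->
  tame (a + g) T C (frac_int a f).
Proof.
move=> a0 g0 fT; have [C0 fc] := fT; split => // t t0T; split; last first.
  exact: frac_int_bound fT t0T.
have /andP[t0 tT] := t0T.
apply/nrm_cvgP; apply/(@cvg_nbhsP R R^o) => u ut.
have [N _ HN] : \forall n \near \oo, [/\ 0 < u n < T, u n <= 2 * t & t <= 2 * u n].
  pose e := Num.min (T - t) (t / 2).
  have e0 : 0 < e by rewrite lt_min subr_gt0 tT divr_gt0.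
  move: ut => /cvgrPdist_lt /(_ e e0); apply: filterS => n.
  rewrite lt_min => /andP[]; rewrite !ltr_norml => /andP[h1 h2] /andP[h3 h4].
  by split; [apply/andP; split|..]; move: h1 h2 h3 h4 t0; lra.
rewrite -(cvg_shiftn N) /=; pose v n := u (n + N)%N.
have vP n : [/\ 0 < v n < T, v n <= 2 * t & t <= 2 * v n].
  by apply: HN; exact: leq_addl.
have vt : v n @[n --> \oo] --> t by rewrite (cvg_shiftn N).
pose K := C / (Gamma a * Gamma g).
have K0 : 0 <= K by rewrite divr_ge0// mulr_ge0// ltW// Gamma_gt0.
pose M := K * (2 `^ `|a + g - 1| * t `^ (a + g - 1)) + K * t `^ (a + g - 1).
have M0 : 0 <= M.
  by apply: addr_ge0; apply: mulr_ge0 => //; rewrite ?mulr_ge0 ?powR_ge0.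
have le_n n : ((nrm (frac_int a f (v n) - frac_int a f t))%:E <=
    \int[leb]_(r in `]0%R, 1%R[) (nrm (rescaled a f (v n) r - rescaled a f t r))%:E)%E.
  have [vT _ _] := vP n.
  rewrite (frac_int_rescaled a0 g0 fT vT) (frac_int_rescaled a0 g0 fT t0T).
  by apply: bochner_dist => //; exact: rescaled_beta fT _.
have int0 : (\int[leb]_(r in `]0%R, 1%R[)
    (nrm (rescaled a f (v n) r - rescaled a f t r))%:E)%E @[n --> \oo] --> 0%E.
  have := @dominated_cvg _ _ R leb `]0%R, 1%R[%classic (measurable_itv _)
    (fun n r => (nrm (rescaled a f (v n) r - rescaled a f t r))%:E) (cst 0%E)
    (fun r => (M * (r `^ (g - 1) * (1 - r) `^ (a - 1)))%:E).
  rewrite integral0; apply.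
  - move=> n; have [vT _ _] := vP n; apply/measurable_EFinP.
    apply: open_continuous_measurable_fun; first exact: itv_open.
    move=> r; rewrite inE /= in_itv /= => r01; apply: cvg_nrm.
    by apply: cvgB; [exact: rescaled_continuous fT vT r01|
      exact: rescaled_continuous fT t0T r01].
  - move=> r; rewrite /= in_itv /= => r01; have /andP[r0 r1] := r01.
    apply: cvg_EFin; first exact: nearW.
    apply/nrm_cvgP.
    have trt : t * r < t by rewrite gtr_pMr.
    have vr : v n * r @[n --> \oo] --> t * r by exact: cvgMr_tmp.
    apply: cvg_scale_real => //; apply: cvg_scale_real.
      apply: (@continuous_cvg _ _ _ _ _ (fun n => v n - v n * r) (g_ a) (t - t * r)).
        by apply: g_continuous; rewrite subr_gt0.
      exact: cvgB.
    apply: (@continuous_cvg _ _ _ _ _ (fun n => v n * r) f (t * r)) => //.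
    by have [] := fc (t * r); rewrite // mulr_gt0//= (lt_trans trt).
  - by [].
  - exact: integrable_beta.
  - move=> n r; rewrite /= in_itv /= => r01; rewrite lee_fin ger0_norm ?nrm_ge0//.
    have [vT vt2 tv2] := vP n; have /andP[v0 _] := vT.
    rewrite (le_trans (nrmB _ _))// /M mulrDl lerD//; last first.
      exact: (rescaled_bound a0 g0 fT t0T r01).
    apply: (le_trans (rescaled_bound a0 g0 fT vT r01)).
    rewrite ler_wpM2r ?mulr_ge0 ?powR_ge0// ler_wpM2l//.
    exact: powR_comparable.
have : (nrm (frac_int a f (v n) - frac_int a f t))%:E @[n --> \oo] --> 0%E.
  apply: (@squeeze_cvge _ _ _ _ (fun=> 0%E) _ _ _ 0%E _ int0); last exact: cvg_cst.
  by apply: nearW => n; rewrite lee_fin nrm_ge0 /=; exact: le_n.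
by move=> /fine_cvg.
Qed.

End fractional_integral.

(** * The Mittag-Leffler function *)

Section mittag_leffler.
Context {R : realType}.
Implicit Types (a b t : R) (l : R[i]).

Local Notation modulus l := (complex.Re `|l : R[i]|).

Lemma modulus_ge0 l : 0 <= modulus l.
Proof. by rewrite -lecR; have := normr_ge0 l; rewrite normc_def /= lecR. Qed.

Lemma modulusX l n : modulus (l ^+ n) = modulus l ^+ n.
Proof.
have nE : `|l| = (modulus l)%:C by rewrite normc_def.
by rewrite normrX {1}nE -rmorphXn.
Qed.

(** In the lower bound of Gamma the base K is chosen with K^a = (2|l| + 1) t^a, which
    makes the n-th term at most c (|l| / (2|l| + 1))^n. *)
Lemma kernel_geometric a b t l : 0 < a -> 0 < b -> 0 < t ->
  exists2 c, 0 <= c & forall n,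
    modulus l ^+ n * g_ (a * n%:R + b) t <= c * 2^-1 ^+ n.
Proof.
move=> a0 b0 t0; pose r := modulus l; pose m := 2 * r + 1.
have r0 : 0 <= r := modulus_ge0 l.
have m0 : 0 < m by rewrite /m; lra.
pose K := t * m `^ a^-1.
have K0 : 0 < K by rewrite mulr_gt0// powR_gt0.
pose c := (K + 1) * expR (K + 1) * (t `^ (b - 1) / K `^ b).
exists c; first by rewrite /c !mulr_ge0 ?expR_ge0 ?invr_ge0 ?powR_ge0// addr_ge0 ?(ltW K0).
move=> n; set p := a * n%:R + b.
have p0 : 0 < p by rewrite /p ltr_wpDl// mulr_ge0// ltW.
have Kp : K `^ p = (t `^ a) ^+ n * m ^+ n * K `^ b.
  rewrite /p powRD ?(lt0r_neq0 K0) ?implybT// powRrM powR_mulrn ?powR_ge0//.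
  congr (_ * _); rewrite -exprMn; congr (_ ^+ _).
  by rewrite /K powRM ?powR_ge0 ?(ltW t0)// -powRrM mulVf ?gt_eqF// powRr1// ltW.
have tp : t `^ (p - 1) = (t `^ a) ^+ n * t `^ (b - 1).
  rewrite (_ : p - 1 = a * n%:R + (b - 1)); last by rewrite /p; ring.
  by rewrite (@powRD _ t (a * n%:R)) ?(lt0r_neq0 t0) ?implybT// powRrM powR_mulrn ?powR_ge0.
have K10 : 0 < K + 1 by rewrite addr_gt0.
have GK : K `^ p * expR (- (K + 1)) / (K + 1) <= Gamma p by exact: Gamma_ge.
have Q0 : 0 < K `^ p * expR (- (K + 1)) / (K + 1).
  by rewrite divr_gt0// mulr_gt0 ?expR_gt0// powR_gt0.
have h1 : g_ p t <= t `^ (p - 1) / (K `^ p * expR (- (K + 1)) / (K + 1)).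
  by rewrite /g_ ler_wpM2l ?powR_ge0// lef_pV2// posrE// (lt_le_trans Q0).
apply: (le_trans (ler_wpM2l (exprn_ge0 n r0) h1)).
have ta0 : (t `^ a) ^+ n != 0 by rewrite expf_neq0// gt_eqF// powR_gt0.
have -> : r ^+ n * (t `^ (p - 1) / (K `^ p * expR (- (K + 1)) / (K + 1))) =
    c * (r / m) ^+ n.
  rewrite Kp tp expRN /c exprMn exprVn; field.
  by rewrite ta0 !gt_eqF// ?expR_gt0 ?powR_gt0// exprn_gt0.
apply: ler_wpM2l.
  by rewrite /c !mulr_ge0 ?expR_ge0 ?invr_ge0 ?powR_ge0// addr_ge0 ?(ltW K0).
rewrite lerXn2r ?nnegrE ?divr_ge0 ?(ltW m0)//.
by rewrite ler_pdivrMr// /m; lra.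
Qed.

Let modulus_le l : modulus l <= `|complex.Re l| + `|complex.Im l|.
Proof.
rewrite normc_def /= -[leRHS]ger0_norm ?addr_ge0// -sqrtr_sqr ler_wsqrtr//.
rewrite sqrrD !real_normK ?num_real//.
by rewrite -addrA lerD2l lerDr mulrn_wge0// mulr_ge0.
Qed.

Let Re_le l : `|complex.Re l| <= modulus l.
Proof. by rewrite normc_def /= -sqrtr_sqr ler_wsqrtr// lerDl sqr_ge0. Qed.

Let Im_le l : `|complex.Im l| <= modulus l.
Proof. by rewrite normc_def /= -sqrtr_sqr ler_wsqrtr// lerDr sqr_ge0. Qed.

Let real_series_cvg (u : nat -> R) (c : R) :
  (forall n, `|u n| <= c * 2^-1 ^+ n) -> cvgn (series u).
Proof.
move=> uc; apply: normed_cvg; apply: (series_le_cvg (v_ := geometric c 2^-1)) => //.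
- by move=> n; exact: normr_ge0.
- by move=> n; exact: le_trans (normr_ge0 _) (uc n).
- by apply: is_cvg_geometric_series; rewrite ger0_norm// invf_lt1// ltr1n.
Qed.

Lemma complex_series_cvg (z : nat -> R[i]) (c : R) :
  (forall n, modulus (z n) <= c * 2^-1 ^+ n) ->
  cvgn (series z : nat -> R[i]^o).
Proof.
move=> zc.
have /cvg_ex[p rp] : cvgn (series (fun n => complex.Re (z n))).
  by apply: (@real_series_cvg _ c) => n; exact: le_trans (Re_le _) (zc n).
have /cvg_ex[q iq] : cvgn (series (fun n => complex.Im (z n))).
  by apply: (@real_series_cvg _ c) => n; exact: le_trans (Im_le _) (zc n).
apply/cvg_ex; exists (p +i* q : R[i]^o); apply/nrm_cvgP.
have ReS n : complex.Re (series z n) = series (fun n => complex.Re (z n)) n.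
  by rewrite /series /= (big_morph (@complex.Re R) (id1 := 0) (op1 := +%R))// => -[? ?] [? ?].
have ImS n : complex.Im (series z n) = series (fun n => complex.Im (z n)) n.
  by rewrite /series /= (big_morph (@complex.Im R) (id1 := 0) (op1 := +%R))// => -[? ?] [? ?].
apply: (@squeeze_cvgr _ _ _ _ (fun=> 0) (fun n =>
  `|series (fun n => complex.Re (z n)) n - p| + `|series (fun n => complex.Im (z n)) n - q|)).
- apply: nearW => n; rewrite nrm_ge0 /=; apply: le_trans (modulus_le _) _.
  have ReB (x y : R[i]) : complex.Re (x - y) = complex.Re x - complex.Re y.
    by case: x y => [? ?] [? ?].
  have ImB (x y : R[i]) : complex.Im (x - y) = complex.Im x - complex.Im y.
    by case: x y => [? ?] [? ?].
  by rewrite ReB ImB -ReS -ImS.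
- exact: cvg_cst.
- have -> : 0 = `|p - p| + `|q - q| by rewrite !subrr normr0 addr0.
  by apply: cvgD; apply: cvg_norm; apply: cvgB => //; exact: cvg_cst.
Qed.

Lemma ml_series a b t l : 0 < a -> 0 < b -> 0 < t ->
  (series (fun n => l ^+ n * (g_ (a * n%:R + b) t)%:C) : nat -> R[i]^o) n @[n --> \oo]
    --> (ml_ a b l t : R[i]^o).
Proof.
move=> a0 b0 t0; have [c c0 cP] := kernel_geometric l a0 b0 t0.
have tb0 : 0 < t `^ (b - 1) by rewrite powR_gt0.
pose z n := (l * (t `^ a)%:C) ^+ n * ((Gamma (a * n%:R + b))^-1)%:C.
have zE n : l ^+ n * (g_ (a * n%:R + b) t)%:C = (t `^ (b - 1))%:C * z n.
  have -> : g_ (a * n%:R + b) t = t `^ (b - 1) * ((t `^ a) ^+ n * (Gamma (a * n%:R + b))^-1).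
    rewrite /g_ (_ : a * n%:R + b - 1 = a * n%:R + (b - 1)); last by ring.
    rewrite (@powRD _ t (a * n%:R)) ?(lt0r_neq0 t0) ?implybT// powRrM powR_mulrn ?powR_ge0//.
    by ring.
  by rewrite /z exprMn !rmorphM /= rmorphXn; ring.
have cz : cvgn (series z : nat -> R[i]^o).
  apply: (@complex_series_cvg z (c / t `^ (b - 1))) => n.
  rewrite mulrAC ler_pdivlMr//.
  have -> : modulus (z n) * t `^ (b - 1) = modulus l ^+ n * g_ (a * n%:R + b) t.
    rewrite -modulusX.
    have gn0 : 0 < g_ (a * n%:R + b) t by rewrite g_gt0// ltr_wpDl// mulr_ge0// ltW.
    have : modulus (l ^+ n * (g_ (a * n%:R + b) t)%:C) = modulus ((t `^ (b - 1))%:C * z n).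
      by rewrite zE.
    have nM x y : modulus (x * y) = modulus x * modulus y.
      by have := @nrmZ R (R[i]^o) x y.
    have nr r : 0 <= r -> modulus r%:C = r.
      by move=> r0; rewrite normc_def /= expr0n addr0 sqrtr_sqr ger0_norm.
    rewrite !nM (nr _ (ltW gn0)) (nr _ (ltW tb0)) => ->; exact: mulrC.
  exact: cP.
have -> : (series (fun n => l ^+ n * (g_ (a * n%:R + b) t)%:C) : nat -> R[i]^o) =
    (fun n => (t `^ (b - 1))%:C *: (series z n : R[i]^o)).
  apply/funext => n; rewrite /series /= scaler_sumr.
  by apply: eq_bigr => k _; rewrite zE.
exact: (@cvg_scale _ R[i]^o _ _ _ _ _ _ cz).
Qed.

End mittag_leffler.

(** * The Neumann series of a resolvent family *)

Section resolvent_family.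
Context (R : realType) (X : completeNormedModType R[i]).
Context (a b : R) (A : linop X) (S : R -> {linear X -> X}).
Hypotheses (a0 : 0 < a) (b0 : 0 < b).
Hypotheses (cA : closed_op A) (AS : generates a b A S).
Implicit Types (x y : X) (l : R[i]).

(** Near 0 the bound is the initial condition, away from 0 it is compactness. *)
Lemma family_tame x T : 0 < T -> exists C, tame b T C (fun s => S s x).
Proof.
move=> T0; have lim0 := @gen_lim0 _ _ _ _ _ _ AS x.
pose phi s := nrm (S s x) / g_ b s.
have phiE s : 0 < s -> nrm ((g_ b s)^-1%:C *: S s x) = phi s.
  by move=> s0; rewrite nrmZr gtr0_norm ?invr_gt0 ?g_gt0// mulrC.
have /nrm_cvgP/cvgrPdist_lt /(_ 1 ltr01) := lim0.
rewrite /at_right near_withinE => /nbhs_ballP[d /= d0 dP].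
have near0 s : 0 < s -> s < d -> phi s <= nrm x + 1.
  move=> s0 sd; have : ball (0 : R) d s.
    by rewrite /ball /= sub0r normrN gtr0_norm.
  move=> /dP /(_ s0); rewrite sub0r normrN ger0_norm ?nrm_ge0// => h.
  rewrite -phiE// -(subrK x (_ *: S s x)) (le_trans (nrmD _ _))// addrC lerD2l.
  exact: ltW.
pose e := Num.min (d / 2) T.
have e0 : 0 < e by rewrite lt_min divr_gt0.
have eT : e <= T by rewrite ge_min lexx orbT.
have ed : e < d by rewrite gt_min ltr_pdivrMr// ltr_pMr// ltr1n.
have [c _ cP] : exists2 c : R, c \in `[e, T] & forall s, s \in `[e, T] -> phi s <= phi c.
  apply: EVT_max => //; apply: continuous_in_subspaceT => s.
  rewrite inE /= in_itv /= => /andP[es _]; have s0 := lt_le_trans e0 es.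
  apply: cvgM; first by apply: cvg_nrm; exact: (gen_cont AS).
  by apply: cvgV; [rewrite gt_eqF// g_gt0|exact: g_continuous].
pose C := Num.max (nrm x + 1) (phi c).
have C0 : 0 <= C by rewrite le_max addr_ge0// nrm_ge0.
exists C; split => // s /andP[s0 sT]; split; first exact: (gen_cont AS).
rewrite -ler_pdivrMr ?g_gt0// -/(phi s) le_max.
have [se|es] := ltP s e; first by rewrite near0// (lt_trans se).
by rewrite orbC cP// in_itv /= es ltW.
Qed.

(* the n-fold fractional integral of the orbit of x *)
Let u n x := iter n (frac_int a) (fun s => S s x).

Let gam n := a * n%:R + b.

Let gam_gt0 n : 0 < gam n.
Proof. by rewrite /gam ltr_wpDl// mulr_ge0// ltW. Qed.

Let gamS n : a + gam n = gam n.+1.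
Proof. by rewrite /gam -natr1; ring. Qed.

Let u_tame n x T C : tame b T C (fun s => S s x) -> tame (gam n) T C (u n x).
Proof.
move=> S_T; elim: n => [|n IH]; first by rewrite /gam mulr0 add0r.
by rewrite -gamS; exact: frac_int_tame.
Qed.

Let u_linear n (c : R[i]) x y s : 0 < s -> u n (c *: x + y) s = c *: u n x s + u n y s.
Proof.
elim: n s => [|n IH] s s0; first by rewrite /u /= linearP.
have s10 : 0 < s + 1 by rewrite addr_gt0.
have [C1 T1] := family_tame x s10.
have [C2 T2] := family_tame y s10.
have [C3 T3] := family_tame (c *: x + y) s10.
apply: (frac_int_linear a0 (gam_gt0 n) (u_tame n T1) (u_tame n T2) (u_tame n T3)).
  by rewrite s0 ltrDl ltr01.
by move=> r /andP[r0 _]; exact: IH.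
Qed.

(* the case n = 0 is the resolvent equation; the induction step applies the fractional
   integral to both sides *)
Let u_A n x s : 0 < s -> dom A (u n.+1 x s) /\
  A (u n.+1 x s) = u n x s - (g_ (gam n) s)%:C *: x.
Proof.
elim: n s => [|n IH] s s0.
  have [_ dv eq] := gen_eq AS x s0; split => //.
  by rewrite /gam mulr0 add0r /u /= eq addrC addKr.
have s10 : 0 < s + 1 by rewrite addr_gt0.
have ss1 : 0 < s < s + 1 by rewrite s0 ltrDl ltr01.
have [C S_T] := family_tame x s10.
have kT := kernel_tame (s + 1) x (gam_gt0 n).
pose h r := (-1) *: ((g_ (gam n) r)%:C *: x) + u n x r.
have hT : tame (gam n) (s + 1) (nrm x + C) h.
  have [C0 uT] := u_tame n S_T; have [_ kT2] := kT.
  split=> [|r r0]; first by rewrite addr_ge0 ?nrm_ge0.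
  have [cu nu] := uT r r0; have [ck nk] := kT2 r r0.
  split; first by apply: cvgD => //; exact: cvg_scale.
  by rewrite /h scaleN1r (le_trans (nrmD _ _))// nrmN mulrDl lerD.
have hA r : 0 < r < s -> dom A (u n.+1 x r) /\ A (u n.+1 x r) = h r.
  move=> /andP[r0 _]; have [d ->] := IH r r0; split => //.
  by rewrite /h scaleN1r addrC.
have [d e] := frac_int_closed cA a0 (gam_gt0 n.+1) (gam_gt0 n) (u_tame n.+1 S_T) hT ss1 hA.
split; first exact: d.
rewrite [LHS]e (frac_int_linear (c := -1) a0 (gam_gt0 n) kT (u_tame n S_T) hT ss1)//.
by rewrite frac_int_kernel// gamS scaleN1r addrC.
Qed.

Let u_comm n x s : 0 < s -> dom A x ->
  dom A (u n x s) /\ A (u n x s) = u n (A x) s.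
Proof.
move=> + dx; elim: n s => [|n IH] s s0; first exact: gen_comm AS s x s0 dx.
have s10 : 0 < s + 1 by rewrite addr_gt0.
have ss1 : 0 < s < s + 1 by rewrite s0 ltrDl ltr01.
have [C S_T] := family_tame x s10.
have [C' S_T'] := family_tame (A x) s10.
apply: (frac_int_closed cA a0 (gam_gt0 n) (gam_gt0 n) (u_tame n S_T) (u_tame n S_T') ss1).
by move=> r /andP[r0 _]; exact: IH.
Qed.

Variables (l : R[i]) (t : R).
Hypothesis t0 : 0 < t.

Let P x N := \sum_(0 <= n < N) l ^+ n *: u n.+1 x t.

(* applying A shifts the series by one index, which reproduces l *: P x N up to the
   first term S t x and a last term that tends to 0 *)
Let P_A x N : dom A (P x N) /\ A (P x N) =
  S t x + l *: P x N - l ^+ N *: u N x t -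
  \sum_(0 <= n < N) (l ^+ n * (g_ (gam n) t)%:C) *: x.
Proof.
have alg (s p q r v w : X) : s + q - r - p + (r - w) = s + (q + v) - v - (p + w).
  by rewrite [s + (q + v)]addrA addrK opprD !addrA [s + q - r - p + r]addrAC subrK.
elim: N => [|N [d e]].
  rewrite /P !big_geq// linop0 scaler0 addr0 expr0 scale1r /u /= subrr subr0.
  by split => //; exact: dom0.
have [dN eN] := u_A N x t0.
have dl : dom A (l ^+ N *: u N.+1 x t) by exact: domZ.
rewrite /P !big_nat_recr//= -/(P x N); split; first exact: domD.
rewrite linopD// e linopZ// eN scalerBr scalerDr !scalerA -exprS.
exact: alg.
Qed.

Let term_bound x : exists c, forall n, nrm (l ^+ n *: u n x t) <= c * 2^-1 ^+ n.
Proof.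
have t10 : 0 < t + 1 by rewrite addr_gt0.
have tt1 : 0 < t < t + 1 by rewrite t0 ltrDl ltr01.
have [C S_T] := family_tame x t10; have [C0 _] := S_T.
have [c c0 cP] := kernel_geometric l a0 b0 t0.
exists (C * c) => n; have [_ uT] := u_tame n S_T; have [_ un] := uT t tt1.
rewrite nrmZ modulusX -mulrA.
apply: le_trans (ler_wpM2l C0 (cP n)).
by rewrite mulrCA ler_wpM2l// exprn_ge0// modulus_ge0.
Qed.

Let P_cvg x : cvgn (P x).
Proof.
have t10 : 0 < t + 1 by rewrite addr_gt0.
have tt1 : 0 < t < t + 1 by rewrite t0 ltrDl ltr01.
have [C S_T] := family_tame x t10; have [C0 _] := S_T.
have [c c0 cP] := kernel_geometric l a0 (addr_gt0 a0 b0) t0.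
have [|v vP _] := @geometric_series_cvg R X (fun n => l ^+ n *: u n.+1 x t) (C * c).
  move=> n; have [_ uT] := u_tame n.+1 S_T; have [_ un] := uT t tt1.
  rewrite nrmZ modulusX -mulrA; apply: le_trans (ler_wpM2l C0 (cP n)).
  rewrite mulrCA; apply: ler_wpM2l; first by rewrite exprn_ge0 ?modulus_ge0.
  by move: un; rewrite -gamS /gam addrCA.
by apply/cvg_ex; exists v.
Qed.

(** This is the convolution at t of S with s |-> s^(a-1) E_(a,a)(l s^a), expanded into a
    Neumann series: only fractional integrals of the family occur, each of which A can be
    applied to. *)
Definition family_convolution x : X := limn (P x).
Local Notation B := family_convolution.

Let B_cvg x : P x n @[n --> \oo] --> B x.
Proof. exact: P_cvg. Qed.

Lemma family_convolution_linear (c : R[i]) x y : B (c *: x + y) = c *: B x + B y.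
Proof.
apply/cvg_lim => //.
have -> : P (c *: x + y) = fun N => c *: P x N + P y N.
  apply/funext => N; rewrite /P scaler_sumr -big_split; apply: eq_bigr => n _.
  by rewrite u_linear// scalerDr !scalerA mulrC.
by apply: cvgD; [apply: cvg_scale|]; exact: B_cvg.
Qed.

Lemma family_convolution_left x :
  dom A (B x) /\ l *: B x - A (B x) = ml_ a b l t *: x - S t x.
Proof.
suff [d e] : dom A (B x) /\ A (B x) = S t x + l *: B x - ml_ a b l t *: x.
  split => //; rewrite e opprB addrCA; congr (_ + _).
  by rewrite opprD addrCA subrr addr0.
apply: (closed_opP cA (u := P x)); [by move=> N; have [] := P_A x N|exact: B_cvg|].
under eq_fun do rewrite (P_A x _).2.
apply: cvgB.
  rewrite -[X in _ --> X]subr0; apply: cvgB.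
    by apply: cvgD; [exact: cvg_cst|apply: cvg_scale; exact: B_cvg].
  have [c cP] := term_bound x.
  apply/nrm_cvgP; apply: (@squeeze_cvgr _ _ _ _ (fun=> 0) (fun n => c * 2^-1 ^+ n)).
  - by apply: nearW => n; rewrite nrm_ge0 subr0 cP.
  - exact: cvg_cst.
  - rewrite -(mulr0 c); apply: cvgMl_tmp.
    by apply: cvg_expr; rewrite ger0_norm// invf_lt1// ltr1n.
under eq_fun do rewrite -scaler_suml.
have /nrm_cvgP ml := ml_series (l := l) a0 b0 t0.
apply/nrm_cvgP; under eq_fun do rewrite -scalerBl nrmZ.
by rewrite -(mul0r (nrm x)); apply: cvgMr_tmp.
Qed.

(** A commutes with every fractional integral of the orbit of x, hence with the sum. *)
Lemma family_convolution_right x : dom A x ->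
  B (l *: x - A x) = ml_ a b l t *: x - S t x.
Proof.
move=> dx; have [_ <-] := family_convolution_left x.
have commP N : dom A (P x N) /\ A (P x N) = P (A x) N.
  have du n : dom A (l ^+ n *: u n.+1 x t) by apply: domZ; have [] := u_comm n.+1 t0 dx.
  have [|d e] := @linop_sum R X A nat (index_iota 0 N) (fun n => l ^+ n *: u n.+1 x t).
    by move=> n _.
  split => //; rewrite [LHS]e; apply: eq_bigr => n _.
  by have [dn en] := u_comm n.+1 t0 dx; rewrite linopZ// en.
have [_ AB] : dom A (B x) /\ A (B x) = B (A x).
  apply: (closed_opP cA (u := P x)); [by move=> N; have [] := commP N|exact: B_cvg|].
  by under eq_fun do rewrite (commP _).2; exact: B_cvg.
have B0 : B 0 = 0.
  have := family_convolution_linear (-1) 0 0.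
  by rewrite scaler0 addr0 scaleN1r addNr.
have -> : - A x = (-1) *: A x + 0 by rewrite scaleN1r addr0.
rewrite AB (family_convolution_linear l x) (family_convolution_linear (-1) (A x)).
by congr (_ + _); rewrite [X in _ + X]B0 scaleN1r addr0.
Qed.

End resolvent_family.

(** * Transfer of the spectrum *)

(** In this part T stands for S t and m for the Mittag-Leffler value: B is a two-sided
    link between l - A and m - T. *)
Section spectral_inclusion.
Context (R : realType) (X : completeNormedModType R[i]).
Context (A : linop X) (T : {linear X -> X}) (B : X -> X) (l m : R[i]).
Hypotheses (cA : closed_op A) (bT : bounded_op T).
Hypothesis B_linear : forall (c : R[i]) x y, B (c *: x + y) = c *: B x + B y.
Hypothesis B_left : forall x, dom A (B x) /\ subop l A (B x) = m *: x - T x.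
Hypothesis B_right : forall x, dom A x -> B (subop l A x) = m *: x - T x.

Let B0 : B 0 = 0.
Proof. by have := B_linear (-1) 0 0; rewrite scaler0 addr0 scaleN1r addNr. Qed.

Let inj_transfer : set_inj setT (subop m (linop_of T)) -> set_inj (dom A) (subop l A).
Proof.
move=> injT x y /set_mem dx /set_mem dy e; apply: injT; rewrite ?inE//.
by rewrite /subop /= -!B_right// e.
Qed.

Lemma point_spectrum_transfer : point_spectrum A l -> point_spectrum (linop_of T) m.
Proof. by move=> nA injT; apply: nA; exact: inj_transfer. Qed.

Let image_sub : subop m (linop_of T) @` setT `<=` subop l A @` dom A.
Proof. by move=> _ [x _ <-]; have [d e] := B_left x; exists (B x). Qed.

Lemma spectrum_transfer : spectrum A l -> spectrum (linop_of T) m.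
Proof.
move=> nA [_ inj surj]; apply: nA; split => //; first exact: inj_transfer.
by move=> y _; apply: image_sub; exact: (surj y I).
Qed.

Lemma residual_spectrum_transfer :
  residual_spectrum A l -> residual_spectrum (linop_of T) m.
Proof.
move=> nA dT; apply: nA => U U0 oU; have [x [Ux Tx]] := dT U U0 oU.
by exists x; split => //; exact: image_sub.
Qed.

Let T_cvg (u : nat -> X) x : u n @[n --> \oo] --> x ->
  m *: u n - T (u n) @[n --> \oo] --> m *: x - T x.
Proof.
move=> ux; apply: cvgB; first exact: cvg_scale.
have [M TM] := bT; have /nrm_cvgP ux0 := ux.
have TMr y : nrm (T y) <= M * nrm y.
  by rewrite -lecR rmorphM /= !nrmE.
apply/nrm_cvgP; apply: (@squeeze_cvgr _ _ _ _ (fun=> 0) (fun n => M * nrm (u n - x))).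
- by apply: nearW => n; rewrite nrm_ge0 /= -linearB TMr.
- exact: cvg_cst.
- by rewrite -(mulr0 M); apply: cvgMl_tmp.
Qed.

Hypothesis injT : set_inj setT (subop m (linop_of T)).
Hypothesis closedT : closed (subop m (linop_of T) @` setT).

Let T_inj x y : m *: x - T x = m *: y - T y -> x = y.
Proof. by move=> e; apply: injT; rewrite ?inE. Qed.

(* B as an everywhere defined operator; its graph is closed because l - A is closed
   and injective *)
Let B_op : linop X := @LinOp R X setT B I (fun _ _ _ _ _ => I)
  (fun c x y _ _ => B_linear c x y).

Let B_bounded : exists M : R, forall x, nrm (B x) <= M * nrm x.
Proof.
have [//|u x y _ ux By|M MP] := @closed_graph R X B_op.
  have dB n : dom A (B (u n)) by have [] := B_left (u n).
  have AB n : A (B (u n)) = l *: B (u n) - (m *: u n - T (u n)).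
    by have [_ <-] := B_left (u n); rewrite /subop opprB addrCA subrr addr0.
  have [dy Ay] : dom A y /\ A y = l *: y - (m *: x - T x).
    apply: (closed_opP cA dB By); under eq_fun do rewrite AB.
    by apply: cvgB; [exact: cvg_scale|exact: T_cvg].
  have [dBx eBx] := B_left x.
  apply: (inj_transfer injT); rewrite ?inE// eBx /subop Ay.
  by rewrite opprB addrCA subrr addr0.
by exists M => x; exact: MP.
Qed.

(* the inverse of m - T, defined on its closed range *)
Let inv_bounded : exists M : R, forall x, nrm x <= M * nrm (m *: x - T x).
Proof.
pose D := subop m (linop_of T) @` setT.
have /choice[V VP] : forall y, exists x, D y -> m *: x - T x = y.
  move=> y; have [[x _ e]|nD] := pselect (D y); last by exists 0.
  by exists x.
have Tlin (c : R[i]) x y : m *: (c *: x + y) - T (c *: x + y) =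
    c *: (m *: x - T x) + (m *: y - T y).
  rewrite (linearP T) scalerDr scalerBr !scalerA [m * c]mulrC opprD.
  by rewrite addrACA.
have D0 : D 0 by exists 0 => //; rewrite /subop /= (linear0 T) scaler0 subrr.
have DP (c : R[i]) x y : D x -> D y -> D (c *: x + y).
  by move=> [p _ <-] [q _ <-]; exists (c *: p + q) => //; rewrite /subop /= Tlin.
have Vlin (c : R[i]) x y : D x -> D y -> V (c *: x + y) = c *: V x + V y.
  by move=> Dx Dy; apply: T_inj; rewrite Tlin !VP//; exact: DP.
pose V_op : linop X := @LinOp R X D V D0 DP Vlin.
have [u y Du uy|u y x Du uy Vx|M MP] := @closed_graph R X V_op.
- by have /closed_setP := closedT; apply; [exact: Du|exact: uy].
- have Dy : D y by have /closed_setP := closedT; apply; [exact: Du|exact: uy].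
  apply: T_inj; rewrite VP//.
  have uE : u = fun n => m *: V (u n) - T (V (u n)).
    by apply/funext => n; rewrite VP//; exact: Du.
  have c1 : u n @[n --> \oo] --> m *: x - T x by rewrite uE; exact: (T_cvg Vx).
  by rewrite -(cvg_lim (@norm_hausdorff _ X) c1) (cvg_lim (@norm_hausdorff _ X) uy).
- exists M => x; have Dx : D (m *: x - T x) by exists x.
  have e : V (m *: x - T x) = x by apply: T_inj; rewrite VP.
  by have := MP _ Dx; rewrite /= e.
Qed.

(** If m - T is injective with closed range, it is bounded below; since it factors through
    l - A by the bounded operator B, so is l - A, and A is closed. *)
Lemma closed_range_transfer : closed (subop l A @` dom A).
Proof.
have [M MP] := B_bounded; have [N NP] := inv_bounded.
pose K := `|N| * `|M|.
have K0 : 0 <= K by rewrite mulr_ge0.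
have bd x : dom A x -> nrm x <= K * nrm (subop l A x).
  move=> dx; apply: (le_trans (NP x)).
  rewrite -B_right// /K -mulrA.
  apply: (@le_trans _ _ (`|N| * nrm (B (subop l A x)))).
    by rewrite ler_wpM2r ?nrm_ge0// ler_norm.
  rewrite ler_wpM2l//; apply: (le_trans (MP _)).
  by rewrite ler_wpM2r ?nrm_ge0// ler_norm.
apply/closed_setP => v y vP vy.
have /choice[x xP] : forall n, exists x, dom A x /\ subop l A x = v n.
  by move=> n; have [x dx e] := vP n; exists x.
have subB p q : dom A p -> dom A q -> subop l A (p - q) = subop l A p - subop l A q.
  by move=> dp dq; rewrite /subop linopB// scalerBr !opprD addrACA.
have /cvg_ex[p xp] : cvgn x.
  apply: nrm_cauchy_cvg => e e0.
  have e1 : 0 < e / (K + 1) / 2 by rewrite !divr_gt0// ltr_wpDl.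
  have /nrm_cvgP/cvgrPdist_lt /(_ _ e1)[n0 _ nP] := vy.
  exists n0 => i j ni nj; have [di ei] := xP i; have [dj ej] := xP j.
  rewrite (le_trans (bd _ (domB di dj)))// subB// ei ej.
  have := nP _ ni; have := nP _ nj; rewrite /= !sub0r !normrN !ger0_norm ?nrm_ge0//.
  move=> hj hi.
  have h : nrm (v i - v j) <= e / (K + 1).
    rewrite -(subrKA y) (le_trans (nrmD _ _))// [nrm (y - _)]nrmBC.
    by rewrite (splitr (e / (K + 1))) lerD// ltW.
  apply: (le_trans (ler_wpM2l K0 h)).
  rewrite mulrA ler_pdivrMr ?ltr_wpDl// mulrC ler_wpM2l ?(ltW e0)//.
  by rewrite lerDl.
have dx n : dom A (x n) by have [] := xP n.
have Ax n : A (x n) = l *: x n - v n.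
  by have [_ <-] := xP n; rewrite /subop opprB addrCA subrr addr0.
have [dp Ap] : dom A p /\ A p = l *: p - y.
  apply: (closed_opP cA dx xp); under eq_fun do rewrite Ax.
  by apply: cvgB => //; exact: cvg_scale.
by exists p => //; rewrite /subop Ap opprB addrCA subrr addr0.
Qed.

End spectral_inclusion.

Theorem theorem4 (R : realType) (X : completeNormedModType R[i])
  (alpha beta omega : R) (A : linop X) (S : R -> {linear X -> X})
  (halpha : 0 < alpha) (hbeta : 0 < beta) (homega : 0 <= omega)
  (Adense : densely_defined A) (Aclosed : closed_op A)
  (AC : classC alpha beta omega A) (AS : generates alpha beta A S)
  (t : R) (ht : 0 < t) :
  [/\ (forall l, spectrum A l ->
         spectrum (linop_of (S t)) (ml_ alpha beta l t)),
      (forall l, point_spectrum A l ->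
         point_spectrum (linop_of (S t)) (ml_ alpha beta l t)),
      (forall l, approx_point_spectrum A l ->
         approx_point_spectrum (linop_of (S t)) (ml_ alpha beta l t)) &
      (forall l, residual_spectrum A l ->
         residual_spectrum (linop_of (S t)) (ml_ alpha beta l t))].
Proof.
have bT := gen_bounded AS ht.
have Bl l := family_convolution_linear halpha hbeta AS l ht.
have BL l := family_convolution_left halpha hbeta Aclosed AS l ht.
have BR l x := @family_convolution_right _ _ _ _ _ _ halpha hbeta Aclosed AS l _ ht x.
split=> l lA.
- exact: spectrum_transfer (BL l) (BR l) lA.
- exact: point_spectrum_transfer (BR l) lA.
- have [injT|] := pselect (set_inj setT (subop (ml_ alpha beta l t) (linop_of (S t))));
    last by left.
  have [clT|] := pselect (closed (subop (ml_ alpha beta l t) (linop_of (S t)) @` setT));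
    last by right.
  case: lA => [/(point_spectrum_transfer (BR l))//|[]].
  exact: (@closed_range_transfer _ _ _ _ _ _ _ Aclosed bT (Bl l) (BL l) (BR l) injT clT).
- exact: residual_spectrum_transfer (BL l) lA.
Qed.
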